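(* Let $X\colon\Sigma^n\to\mathbb{R}^{n+1}$ be a complete, $n$-dimensional, properly immersed, weakly convex self-shrinker of the Gaussian curvature flow, i.e. $K=-\langle X,N\rangle$. If $\sigma_{n-1}$ is bounded and $$HK\le n,$$ then $\Sigma^n$ is one of the following: (i) the unit round sphere $\mathbb{S}^n(1)$; (ii) a hyperplane in $\mathbb{R}^{n+1}$. In particular, if $HK<n$, then $\Sigma^n$ is a hyperplane in $\mathbb{R}^{n+1}$.
   Context: $X\colon\Sigma^n\to\mathbb{R}^{n+1}$ is a smooth isometric immersion of a connected $n$-dimensional Riemannian manifold without boundary, with a continuous globally defined unit normal field $N$. ''$\Sigma^n$ is a hyperplane (sphere)'' means that its image $X(\Sigma^n)$ is such a hypersurface (the sphere being centered at the origin). The shape operator is $A(Y)=-\overline{\nabla}_Y N$, with $\overline\nabla$ the Levi-Civita connection of $\mathbb{R}^{n+1}$; its eigenvalues $k_1,\dots,k_n$ are the principal curvatures. The $r$-mean curvatures are $\sigma_0=1$ and $\sigma_r=\sum_{i_1<\cdots<i_r}k_{i_1}\cdots k_{i_r}$ for $1\le r\le n$; $H=\sigma_1=k_1+\cdots+k_n$ is the mean curvature and $K=\sigma_n=k_1\cdots k_n$ the Gauss-Kronecker curvature. The convention on $N$ is that on closed hypersurfaces (e.g. spheres) $N$ points inward, so round spheres have positive principal curvatures. Weakly convex means that $A$ is positive semidefinite. A self-shrinker of the Gaussian curvature flow (the $r$-mean curvature flow with $r=n$) is a hypersurface satisfying $\sigma_n=-\langle X,N\rangle$, where $X$ is the position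 vector. *)

(* Defs.v *)
From HB Require Import structures.
From mathcomp Require Import all_boot all_order all_algebra.
From mathcomp Require Import all_classical all_reals all_analysis.

Set Implicit Arguments.
Unset Strict Implicit.
Unset Printing Implicit Defensive.

Import Order.TTheory GRing.Theory Num.Theory.
Import numFieldNormedType.Exports.

Local Open Scope classical_set_scope.
Local Open Scope ring_scope.

(** The norm carried by 'rV[R]_m in the library is the sup norm; it is only
    used for topology and differentiation.  The Euclidean structure is [dotr]. *)
Definition bform {R : realType} {m : nat} (G : 'M[R]_m) (v w : 'rV[R]_m) : R :=
  (v *m G *m w^T) 0 0.

Definition dotr {R : realType} {m : nat} (v w : 'rV[R]_m) : R :=
  \sum_(i < m) v 0 i * w 0 i.

(** [f] is of class C^k on the set [U], meant for open [U]. *)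
Fixpoint Ck {R : realType} {V W : normedModType R} (k : nat) (U : set V)
    (f : V -> W) : Prop :=
  if k is k'.+1 then
    (forall x, U x -> differentiable f x) /\ (forall v : V, Ck k' U ('D_v f))
  else forall x, U x -> {for x, continuous f}.

Definition smooth_on {R : realType} {V W : normedModType R} (U : set V)
    (f : V -> W) : Prop := forall k, Ck k U f.

(** A smooth atlas without boundary.  The chart [i] is the homeomorphism
    [coord i : dom i -> cod i] onto an open subset of R^n, with inverse
    [param i]; values outside [dom i], [cod i] are irrelevant.  [chart_at]
    selects a chart around each point, so that pointwise tensors can be written
    as matrices; no invariant below depends on the selection. *)
Record smooth_atlas (R : realType) (n : nat) (M : topologicalType) :=
  SmoothAtlas {
    chart : Type ;
    dom : chart -> set M ;
    cod : chart -> set 'rV[R]_n ;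
    coord : chart -> M -> 'rV[R]_n ;
    param : chart -> 'rV[R]_n -> M ;
    chart_at : M -> chart ;
    dom_open : forall i, open (dom i) ;
    cod_open : forall i, open (cod i) ;
    coord_cod : forall i p, dom i p -> cod i (coord i p) ;
    param_dom : forall i u, cod i u -> dom i (param i u) ;
    coordK : forall i p, dom i p -> param i (coord i p) = p ;
    paramK : forall i u, cod i u -> coord i (param i u) = u ;
    coord_continuous : forall i p, dom i p -> {for p, continuous (coord i)} ;
    param_continuous : forall i u, cod i u -> {for u, continuous (param i)} ;
    chart_atP : forall p, dom (chart_at p) p ;
    transition_smooth : forall i j,
      smooth_on (cod i `&` param i @^-1` dom j) (coord j \o param i)
  }.

Definition smooth_map {R : realType} {n m : nat} {M : topologicalType}
    (S : smooth_atlas R n M) (X : M -> 'rV[R]_m) : Prop :=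
  forall i : chart S, smooth_on (cod i) (X \o param i).

(** [gmx i u] is the Gram matrix of the metric in the coordinate frame of the
    chart [i], at the point of coordinates [u]. *)
Record riemannian_metric (R : realType) (n : nat) (M : topologicalType)
    (S : smooth_atlas R n M) :=
  RiemannianMetric {
    gmx : chart S -> 'rV[R]_n -> 'M[R]_n ;
    gmx_smooth : forall i, smooth_on (cod i) (gmx i) ;
    gmx_sym : forall i u, cod i u -> (gmx i u)^T = gmx i u ;
    gmx_pos : forall i u v, cod i u -> v != 0 -> 0 < bform (gmx i u) v v ;
    gmx_transition : forall (i j : chart S) u v w,
      cod i u -> dom j (param i u) ->
      let t := coord j \o param i in
      bform (gmx i u) v w = bform (gmx j (t u)) ('D_v t u) ('D_w t u)
  }.

Section Distance.
Context {R : realType} {n : nat} {M : topologicalType}.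
Context {S : smooth_atlas R n M} (g : riemannian_metric S).

Definition arc_length (i : chart S) (c : R -> 'rV[R]_n) : \bar R :=
  (\int[lebesgue_measure]_(t in `[0%R, 1%R])
     (Num.sqrt (bform (gmx g i (c t)) (derive1 c t) (derive1 c t)))%:E)%E.

(** [piecewise_C1 p q l]: some piecewise C^1 curve of length [l] goes from [p]
    to [q].  Such a curve is a finite concatenation of C^1 arcs, each lying in
    the domain of one chart; an arc on [0, 1] is given as the restriction of a
    C^1 map on the real line. *)
Inductive piecewise_C1 : M -> M -> \bar R -> Prop :=
| PC1_nil p : piecewise_C1 p p 0%E
| PC1_arc (i : chart S) (c : R -> 'rV[R]_n) (q : M) (l : \bar R) :
    Ck 1 [set: R] c ->
    (forall t, 0 <= t <= 1 -> cod i (c t)) ->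
    piecewise_C1 (param i (c 1)) q l ->
    piecewise_C1 (param i (c 0)) q (arc_length i c + l)%E.

Definition rdist (p q : M) : \bar R :=
  ereal_inf [set l | piecewise_C1 p q l].

Definition riemannian_complete : Prop :=
  forall x : nat -> M,
    (forall e : R, 0 < e -> exists k : nat, forall a b : nat,
       (k <= a)%N -> (k <= b)%N -> (rdist (x a) (x b) < e%:E)%E) ->
    exists p : M, forall e : R, 0 < e -> exists k : nat, forall a : nat,
       (k <= a)%N -> (rdist (x a) p < e%:E)%E.

End Distance.

Definition proper_map {T U : topologicalType} (f : T -> U) : Prop :=
  continuous f /\ forall B : set U, compact B -> compact (f @^-1` B).

Section Hypersurface.
Context {R : realType} {n : nat} {M : topologicalType}.
Context {S : smooth_atlas R n M} (g : riemannian_metric S).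
Variables X N : M -> 'rV[R]_n.+1.

(** The differential of such an [X] is injective because [g] is definite. *)
Definition isometric_immersion : Prop :=
  smooth_map S X /\
  forall (i : chart S) u v w, cod i u ->
    dotr ('D_v (X \o param i) u) ('D_w (X \o param i) u) = bform (gmx g i u) v w.

Definition unit_normal_field : Prop :=
  [/\ continuous N,
      forall p, dotr (N p) (N p) = 1 &
      forall (i : chart S) u v, cod i u ->
        dotr ('D_v (X \o param i) u) (N (param i u)) = 0].

(** Matrix of the shape operator at [p] in the coordinate frame of
    [chart_at S p], acting on row vectors: dX (A v) = - dN v. *)
Definition shape_operator (p : M) : 'M[R]_n :=
  let i := chart_at S p in
  let u := coord i p in
  xget 0 [set A : 'M[R]_n | forall v : 'rV[R]_n,
    'D_(v *m A) (X \o param i) u = - 'D_v (N \o param i) u].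

(** The eigenvalues of the shape operator, with multiplicity, in some order. *)
Definition principal_curvatures (p : M) : n.-tuple R :=
  xget [tuple of nseq n 0] [set k : n.-tuple R |
    char_poly (shape_operator p) = \prod_(a <- k) ('X - a%:P)].

Definition sigma (r : nat) (p : M) : R :=
  \sum_(I : {set 'I_n} | #|I| == r)
    \prod_(j in I) tnth (principal_curvatures p) j.

Definition mean_curvature (p : M) : R :=
  \sum_(j < n) tnth (principal_curvatures p) j.

Definition gauss_kronecker (p : M) : R :=
  \prod_(j < n) tnth (principal_curvatures p) j.

Definition weakly_convex : Prop :=
  forall (p : M) (v : 'rV[R]_n),
    let i := chart_at S p in
    0 <= bform (gmx g i (coord i p)) (v *m shape_operator p) v.

Definition gauss_self_shrinker : Prop :=
  forall p, gauss_kronecker p = - dotr (X p) (N p).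

Definition is_unit_sphere : Prop :=
  range X = [set x : 'rV[R]_n.+1 | dotr x x = 1].

Definition is_hyperplane : Prop :=
  exists (a : 'rV[R]_n.+1) (c : R),
    a != 0 /\ range X = [set x : 'rV[R]_n.+1 | dotr a x = c].

End Hypersurface.

Arguments shape_operator {R n M} S X N p.
Arguments principal_curvatures {R n M} S X N p.
Arguments sigma {R n M} S X N r p.
Arguments mean_curvature {R n M} S X N p.
Arguments gauss_kronecker {R n M} S X N p.
Arguments unit_normal_field {R n M} S X N.
Arguments gauss_self_shrinker {R n M} S X N.

(* Main.v *)
Require Import Defs.
From HB Require Import structures.
From mathcomp Require Import all_boot all_order all_algebra.
From mathcomp Require Import all_classical all_reals all_analysis.
From mathcomp Require Import fingroup perm.
From mathcomp Require Import ring lra.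

Set Implicit Arguments.
Unset Strict Implicit.
Unset Printing Implicit Defensive.

Import Order.TTheory GRing.Theory Num.Theory.
Import numFieldNormedType.Exports.

Local Open Scope classical_set_scope.
Local Open Scope ring_scope.

(** The principal curvatures [k_1, ..., k_n] are nonnegative; let [P_j] be the
    product of all of them but [k_j], so that [P_j k_j = K] and [sigma_(n-1)]
    is the sum of the [P_j]. These are the eigenvalues of the Newton
    transformation [P]. The equation [K = - <X, N>] says that the curvature is
    the support function; differentiating it twice and using the Codazzi
    equation gives, for the operator [L f = tr (P Hess f) - <X, grad f>],
<<
      L K           = K (n - H K) >= 0,
      L (|X|^2 / 2) = sigma_(n-1) - n K^2 - |X|^2 + K^2.
>>
    The proof is the maximum principle for [L], which may degenerate where
    [K = 0]. All of it goes through [local_max_inequality], the inequality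
    satisfied at a local maximum of [K + rho (|X - y|^2 / 2)], for a function
    [rho] of one variable and a point [y] of the ambient space. At a maximum
    the first order terms are known, so neither a connection nor the operator
    [L] has to be introduced: second derivatives along constant directions of a
    chart suffice, taken in a principal frame ([principal_frame]).

    Taking [rho s = - eps * s] bounds the position of the maximum points
    independently of [eps], by the bound on [sigma_(n-1)]; since [X] is proper,
    [K] attains its maximum ([gauss_kronecker_attains_max]).

    If the maximum [m] is positive, [rho = 0] gives [H K = n] at a maximum point
    ([max_HK]), which excludes [H K < n]. An exponential [rho] gives Hopf's
    strong maximum principle ([maximum_set_open]), so [K = m] everywhere by
    connectedness. As [grad K = A X^T] with [A] invertible, [X] is normal
    ([max_position]); thus the image is in the sphere of radius [m], whose
    curvature forces [m = 1], and it is the whole sphere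
    ([constant_curvature_sphere]).

    If the maximum is 0, then [K = 0] and [X] is everywhere tangent, with [N]
    constant in the direction of [X]. So each value of [N] is also attained at a
    zero of [X] ([exists_zero_with_normal]). The zeros are isolated and form a
    compact set, hence [N] is constant ([normal_constant]) and the image is a
    hyperplane ([zero_curvature_hyperplane]). *)

(** * Euclidean linear algebra *)

Section DotProduct.
Context {R : realType} {m : nat}.
Implicit Types u v w : 'rV[R]_m.

Lemma dotrC v w : dotr v w = dotr w v.
Proof. by apply: eq_bigr => i _; rewrite mulrC. Qed.

Lemma dotrDl u v w : dotr (u + v) w = dotr u w + dotr v w.
Proof. by rewrite -big_split; apply: eq_bigr => i _; rewrite mxE mulrDl. Qed.

Lemma dotrZl c v w : dotr (c *: v) w = c * dotr v w.
Proof. by rewrite /dotr mulr_sumr; apply: eq_bigr => i _; rewrite mxE mulrA. Qed.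

Lemma dotrNl v w : dotr (- v) w = - dotr v w.
Proof. by rewrite -scaleN1r dotrZl mulN1r. Qed.

Lemma dotrBl u v w : dotr (u - v) w = dotr u w - dotr v w.
Proof. by rewrite dotrDl dotrNl. Qed.

Lemma dotr0l w : dotr 0 w = 0.
Proof. by rewrite -(scale0r 0) dotrZl mul0r. Qed.

Lemma dotrDr u v w : dotr u (v + w) = dotr u v + dotr u w.
Proof. by rewrite dotrC dotrDl !(dotrC u). Qed.

Lemma dotrZr c v w : dotr v (c *: w) = c * dotr v w.
Proof. by rewrite dotrC dotrZl (dotrC v). Qed.

Lemma dotrNr v w : dotr v (- w) = - dotr v w.
Proof. by rewrite dotrC dotrNl (dotrC v). Qed.

Lemma dotrBr u v w : dotr u (v - w) = dotr u v - dotr u w.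
Proof. by rewrite dotrDr dotrNr. Qed.

Lemma dotr0r v : dotr v 0 = 0.
Proof. by rewrite dotrC dotr0l. Qed.

Lemma dotr_suml (I : finType) (F : I -> 'rV[R]_m) w :
  dotr (\sum_i F i) w = \sum_i dotr (F i) w.
Proof. by elim/big_rec2: _ => [|i x y _ <-]; rewrite ?dotr0l ?dotrDl. Qed.

Lemma dotr_sumr (I : finType) (F : I -> 'rV[R]_m) w :
  dotr w (\sum_i F i) = \sum_i dotr w (F i).
Proof. by rewrite dotrC dotr_suml; apply: eq_bigr => i _; rewrite dotrC. Qed.

Lemma dotr_mx v w : dotr v w = (v *m w^T) 0 0.
Proof. by rewrite mxE; apply: eq_bigr => i _; rewrite mxE. Qed.

Lemma dotr_ge0 v : 0 <= dotr v v.
Proof. by apply: sumr_ge0 => i _; rewrite -expr2 sqr_ge0. Qed.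

Lemma dotr_eq0 v : dotr v v = 0 -> v = 0.
Proof.
move=> /eqP; rewrite psumr_eq0 => [/allP v0|i _]; last by rewrite -expr2 sqr_ge0.
apply/rowP => i; rewrite mxE; apply/eqP.
by have := v0 i (mem_index_enum i); rewrite mulf_eq0 orbb.
Qed.

Lemma dotr_gt0 v : v != 0 -> 0 < dotr v v.
Proof.
move=> v0; rewrite lt_def dotr_ge0 andbT; apply: contra_neq v0; exact: dotr_eq0.
Qed.

End DotProduct.

Lemma cvg_coord {R : realType} {T : Type} (F : set_system T) {FF : Filter F}
    {m k} (f : T -> 'M[R]_(m, k)) (v : 'M[R]_(m, k)) i j :
  f @ F --> v -> (fun t => f t i j) @ F --> v i j.
Proof.
move=> fv; apply: (cvg_comp f (fun A : 'M[R]_(m, k) => A i j) fv).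
exact: coord_continuous.
Qed.

Lemma cvg_mx_coord {R : realType} {T : Type} (F : set_system T) {FF : Filter F}
    {m k} (f : T -> 'M[R]_(m, k)) (v : 'M[R]_(m, k)) :
  (forall i j, (fun t => f t i j) @ F --> v i j) -> f @ F --> v.
Proof.
move=> fv; apply/cvgrPdist_le => /= e e0; near=> t.
rewrite /Num.Def.normr/= mx_normrE (bigmax_le _ (ltW e0))//= => i _.
rewrite !mxE/=; move: i; near: t; apply: filter_forall => /= i.
exact: ((cvgrPdist_le _ _).1 (fv i.1 i.2)).
Unshelve. all: by end_near. Qed.

Lemma cvg_dotr {R : realType} {T : Type} (F : set_system T) {FF : Filter F}
    {m} (f g : T -> 'rV[R]_m) (v w : 'rV[R]_m) :
  f @ F --> v -> g @ F --> w -> (fun t => dotr (f t) (g t)) @ F --> dotr v w.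
Proof.
move=> fv gw; apply: cvg_big; first exact: add_continuous.
by move=> k _; apply: cvgM; exact: cvg_coord.
Qed.

Lemma dotr_mulmx {R : realType} {k m} (u : 'rV[R]_k) (A : 'M[R]_(k, m)) v :
  dotr (u *m A) v = dotr u (v *m A^T).
Proof. by rewrite !dotr_mx trmx_mul trmxK mulmxA. Qed.

Section BilinearForms.
Context {R : realType} {n : nat}.
Implicit Types (G B : 'M[R]_n) (u v w : 'rV[R]_n).

Lemma bformE G v w : bform G v w = dotr (v *m G) w.
Proof. by rewrite dotr_mx. Qed.

Lemma bformDl G u v w : bform G (u + v) w = bform G u w + bform G v w.
Proof. by rewrite !bformE mulmxDl dotrDl. Qed.

Lemma bformDr G u v w : bform G u (v + w) = bform G u v + bform G u w.
Proof. by rewrite !bformE dotrDr. Qed.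

Lemma bformZl G c v w : bform G (c *: v) w = c * bform G v w.
Proof. by rewrite !bformE -scalemxAl dotrZl. Qed.

Lemma bformZr G c v w : bform G v (c *: w) = c * bform G v w.
Proof. by rewrite !bformE dotrZr. Qed.

Lemma bform_suml (I : finType) (F : I -> 'rV[R]_n) G w :
  bform G (\sum_i F i) w = \sum_i bform G (F i) w.
Proof.
by rewrite bformE mulmx_suml dotr_suml; apply: eq_bigr => i _; rewrite bformE.
Qed.

Lemma bform_sym G v w : G^T = G -> bform G v w = bform G w v.
Proof. by move=> Gs; rewrite !bformE dotr_mulmx Gs dotrC. Qed.

Lemma cvg_bform {T : Type} (F : set_system T) {FF : Filter F}
    (f g : T -> 'rV[R]_n) G v w :
  f @ F --> v -> g @ F --> w -> (fun t => bform G (f t) (g t)) @ F --> bform G v w.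
Proof.
move=> fv gw; rewrite bformE; under eq_fun do rewrite bformE.
apply: (cvg_dotr _ gw).
apply: cvg_mx_coord => i j; rewrite !mxE; under eq_fun do rewrite mxE.
apply: cvg_big; first exact: add_continuous.
by move=> k _; apply: cvgMl; exact: cvg_coord.
Qed.

Lemma bform_continuous G : continuous (fun v => bform G v v).
Proof. by move=> v; apply: (@cvg_bform _ (nbhs v) _ id id G v v); exact: cvg_id. Qed.

(** The first variation of a quadratic function bounded above by its value at 0. *)
Lemma quadratic_le0 (a b : R) : (forall t, 2 * t * a + t ^+ 2 * b <= 0) -> a = 0.
Proof.
move=> h; apply/eqP/negPn/negP => a0.
have b1 : 0 < b ^+ 2 + 1 by have := sqr_ge0 b; lra.
have := h (a / (b ^+ 2 + 1)).
have -> : 2 * (a / (b ^+ 2 + 1)) * a + (a / (b ^+ 2 + 1)) ^+ 2 * b =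
  (a / (b ^+ 2 + 1)) ^+ 2 * (2 * (b ^+ 2 + 1) + b).
  by field; rewrite gt_eqF.
rewrite leNgt => /negP; apply; apply: mulr_gt0.
  by rewrite exprn_even_gt0//= mulf_neq0// invr_eq0 gt_eqF.
by have := sqr_ge0 (b + 1); have := sqr_ge0 b; lra.
Qed.

Lemma exists_orthogonal_vector G (k : nat) (e : nat -> 'rV[R]_n) : (k < n)%N ->
  exists2 v : 'rV[R]_n, v != 0 & forall j, (j < k)%N -> bform G v (e j) = 0.
Proof.
move=> kn; pose V := \matrix_(j < k) (e j *m G^T).
have : kermx V^T != 0.
  rewrite -mxrank_eq0 mxrank_ker mxrank_tr -lt0n subn_gt0.
  exact: leq_ltn_trans (rank_leq_row _) kn.
case/rowV0Pn => v /sub_kermxP vV v0; exists v => // j jk.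
move/matrixP/(_ 0 (Ordinal jk)): vV; rewrite mxE [RHS]mxE => vV.
rewrite bformE dotr_mulmx -[RHS]vV.
by apply: eq_bigr => i _; rewrite !mxE.
Qed.

Lemma unit_sphere_compact : compact [set v : 'rV[R]_n | `|v| = 1].
Proof.
apply: bounded_closed_compact.
  by exists 1; split => // x x1 v /= ->; exact: ltW.
apply: (@preimage_closed _ _ (fun v : 'rV[R]_n => `|v|) [set 1]).
  by move=> v _; exact: norm_continuous.
exact: closed_eq.
Qed.

(** The Rayleigh quotient is invariant under scaling, so its maximum may be
    taken over the compact unit sphere of the norm and rescaled afterwards. *)
Lemma rayleigh_maximum G B (A : set 'rV[R]_n) :
  (forall v, v != 0 -> 0 < bform G v v) ->
  closed A -> (forall c v, A v -> A (c *: v)) -> (exists2 v, v != 0 & A v) ->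
  exists v, [/\ A v, bform G v v = 1 &
    forall w, A w -> bform B w w <= bform B v v * bform G w w].
Proof.
move=> Gpos Acl Asc [v0 v0n Av0].
pose q v := bform B v v / bform G v v.
have qZ c v : c != 0 -> q (c *: v) = q v.
  move=> c0; rewrite /q !bformZl !bformZr !mulrA -expr2.
  have [->|/Gpos/lt0r_neq0 Gv] := eqVneq v 0; last by field; rewrite c0 Gv.
  by rewrite !bformE dotr0r !(mul0r, mulr0, invr0).
pose K := A `&` [set v : 'rV[R]_n | `|v| = 1].
have normK w : A w -> w != 0 -> K (`|w|^-1 *: w).
  move=> Aw w0; split; first exact: Asc.
  by rewrite /= normrZ normfV normr_id mulVf// normr_eq0.
have [||c|v vK vmax] := @EVT_max_rV R n q K.
- by exists (`|v0|^-1 *: v0); exact: normK.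
- rewrite /K setIC; apply: compact_closedI => //; exact: unit_sphere_compact.
- apply: continuous_in_subspaceT => v /set_mem [_ /= v1].
  have v_neq0 : v != 0 by rewrite -normr_gt0 v1.
  apply: (@cvgM _ _ (nbhs v) _ (fun v => bform B v v) (fun v => (bform G v v)^-1)).
    exact: bform_continuous.
  by apply: cvgV; [rewrite gt_eqF ?Gpos|exact: bform_continuous].
have [Av v1] := set_mem vK.
have v_neq0 : v != 0 by rewrite -normr_gt0 v1.
have Gv := Gpos v v_neq0.
pose s := (Num.sqrt (bform G v v))^-1.
have s0 : s != 0 by rewrite invr_eq0 sqrtr_eq0 -ltNge.
have s2 : s ^+ 2 * bform G v v = 1.
  by rewrite exprVn sqr_sqrtr ?mulVf ?gt_eqF// ltW.
exists (s *: v); split; first exact: Asc.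
  by rewrite bformZl bformZr mulrA -expr2.
move=> w Aw; have [->|w0] := eqVneq w 0; first by rewrite !bformE !dotr0r mulr0.
have := vmax _ (mem_set (normK _ Aw w0)).
rewrite qZ ?invr_eq0 ?normr_eq0// -[q v](qZ s)// /q ler_pdivrMr ?Gpos//.
by rewrite [bform G (s *: v) _]bformZl [bform G v (s *: v)]bformZr mulrA -expr2 s2 divr1.
Qed.

(** Eigenvectors are found one at a time: each maximises the Rayleigh quotient
    on the [G]-orthogonal complement [A] of the previous ones. Sequences indexed
    by [nat] keep the induction free of casts between dimensions. *)
Lemma simultaneous_diagonalization G B :
  G^T = G -> B^T = B -> (forall v, v != 0 -> 0 < bform G v v) ->
  exists (e : 'I_n -> 'rV[R]_n) (d : 'I_n -> R),
    (forall i j, bform G (e i) (e j) = (i == j)%:R) /\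
    (forall i w, bform B (e i) w = d i * bform G (e i) w).
Proof.
move=> Gs Bs Gpos.
suff ih : forall k, (k <= n)%N ->
    exists (e : nat -> 'rV[R]_n) (d : nat -> R),
    (forall i j, (i < k)%N -> (j < k)%N -> bform G (e i) (e j) = (i == j)%:R) /\
    (forall i w, (i < k)%N -> bform B (e i) w = d i * bform G (e i) w).
  have [e [d [eG eB]]] := ih n (leqnn n).
  exists (fun i => e i), (fun i => d i).
  by split=> [i j|i w]; [exact: eG|exact: eB].
elim=> [_|k ihk kn]; first by exists (fun=> 0), (fun=> 0).
have [e [d [eG eB]]] := ihk (ltnW kn).
pose A : set 'rV[R]_n := \bigcap_(j in [set j | (j < k)%N]) [set v | bform G v (e j) = 0].
have [||||v [Av v1 vmax]] := @rayleigh_maximum G B A.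
- exact: Gpos.
- apply: closed_bigI => j _.
  apply: (@preimage_closed _ _ (fun v => bform G v (e j)) [set 0]).
    by move=> v _; apply: (@cvg_bform _ (nbhs v) _ id (cst (e j)) G v (e j));
      [exact: cvg_id|exact: cvg_cst].
  exact: closed_eq.
- by move=> c v Av j jk; rewrite /= bformZl Av ?mulr0.
- have [v v0 vk] := exists_orthogonal_vector G e kn.
  by exists v => // j jk; exact: vk.
pose l := bform B v v.
(* the first variation of the Rayleigh quotient in a direction of [A] *)
have vA w : A w -> bform B v w = l * bform G v w.
  move=> Aw; apply/eqP; rewrite -subr_eq0; apply/eqP.
  apply: (@quadratic_le0 _ (bform B w w - l * bform G w w)) => t.
  have := vmax (v + t *: w).
  rewrite -/l !(bformDl, bformDr, bformZl, bformZr) v1.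
  rewrite (bform_sym w v Bs) (bform_sym w v Gs) -/l => h.
  have /h {}h : A (v + t *: w).
    by move=> j jk; rewrite /= bformDl bformZl Av ?Aw// mulr0 addr0.
  lra.
have vB w : bform B v w = l * bform G v w.
  pose w' := w - \sum_(j < k) bform G w (e j) *: e j.
  have Aw' : A w'.
    move=> j jk /=; rewrite bformE mulmxBl dotrBl -!bformE bform_suml.
    rewrite (bigD1 (Ordinal jk))//= bformZl eG// eqxx mulr1 big1 ?addr0 ?subrr//.
    by move=> i; rewrite -val_eqE /= => /negPf ij; rewrite bformZl eG// ij mulr0.
  have ve (C : 'M[R]_n) : (forall j, (j < k)%N -> bform C v (e j) = 0) ->
      bform C v w = bform C v w'.
    move=> C0; rewrite /w' !bformE dotrBr dotr_sumr big1 ?subr0// => j _.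
    by rewrite dotrZr -bformE C0 ?mulr0.
  have vB0 j : (j < k)%N -> bform B v (e j) = 0.
    move=> jk; rewrite (bform_sym _ _ Bs) (eB _ _ jk) (bform_sym _ _ Gs) (Av j jk).
    exact: mulr0.
  by rewrite (ve G Av) (ve B vB0); exact: vA Aw'.
exists (fun i => if i == k then v else e i), (fun i => if i == k then l else d i).
split.
  move=> i j; rewrite !ltnS (leq_eqVlt i) (leq_eqVlt j).
  case: (eqVneq i k) => [->|ik]; case: (eqVneq j k) => [->|jk] //=.
  - by move=> _ jk'; exact: Av.
  - by move=> ik' _; rewrite (bform_sym _ _ Gs) (Av i ik') (negPf ik).
  - by move=> ik' jk'; exact: eG.
move=> i w; rewrite ltnS leq_eqVlt; case: (eqVneq i k) => [_ _|_ /= ik].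
  exact: vB.
exact: eB.
Qed.

End BilinearForms.

(** A full orthonormal family is a matrix [O] with [O *m O^T = 1], hence also
    [O^T *m O = 1]; the normal is treated apart from the tangent vectors since
    this is how the expansion is used. *)
Lemma orthonormal_expansion {R : realType} {n} (E : 'I_n -> 'rV[R]_n.+1)
    (N : 'rV[R]_n.+1) :
  (forall i j, dotr (E i) (E j) = (i == j)%:R) -> (forall i, dotr (E i) N = 0) ->
  dotr N N = 1 ->
  forall v, v = \sum_i dotr v (E i) *: E i + dotr v N *: N.
Proof.
move=> EE EN NN v.
pose f (i : 'I_n.+1) := if unlift ord0 i is Some j then E j else N.
have ff i j : dotr (f i) (f j) = (i == j)%:R.
  rewrite /f; case: unliftP => [i' ->|->]; case: unliftP => [j' ->|->].
  - by rewrite EE (inj_eq lift_inj).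
  - by rewrite EN eq_sym (negPf (neq_lift _ _)).
  - by rewrite dotrC EN (negPf (neq_lift _ _)).
  - by rewrite NN eqxx.
pose O := \matrix_i f i.
have : O *m O^T = 1%:M.
  apply/matrixP => i j; rewrite [RHS]mxE -ff mxE.
  by apply: eq_bigr => k _; rewrite !mxE.
move/mulmx1C/(congr1 (mulmx v)); rewrite mulmx1 => {1}<-.
have cE i : (v *m O^T) 0 i = dotr v (f i).
  by rewrite mxE; apply: eq_bigr => k _; rewrite !mxE.
rewrite mulmxA mulmx_sum_row big_ord_recl rowK cE /f unlift_none addrC.
by congr (_ + _); apply: eq_bigr => i _; rewrite rowK cE /f liftK.
Qed.

(** * Directional derivatives and local maxima *)

Section DirectionalDerivatives.
Context {R : realType} {V : normedModType R}.

(** Differentiability is local; this is what lets the formulas for derivatives,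
    valid on an open set only, be differentiated again. *)
Lemma near_eq_differentiable {W : normedModType R} (f g : V -> W) (x : V) :
  (\forall y \near x, f y = g y) -> differentiable f x -> differentiable g x.
Proof.
move=> fg df; have /diff_locallyP [dc fE] := df.
have gE : g \o shift x = cst (g x) + 'd f x +o_ 0 id.
  apply/eqaddoP => e e0.
  have fg0 : \forall h \near 0, f (h + x) = g (h + x).
    have c : (fun h => h + x) @ (0 : V) --> x.
      by rewrite -[X in _ --> X]add0r; apply: cvgD; [exact: cvg_id|exact: cvg_cst].
    exact: (c _ fg).
  have := (eqaddoP _ _ _ _).1 fE e e0.
  apply: filter_app; apply: filterS fg0 => h fgh.
  by rewrite !fctE /= fgh (nbhs_singleton fg).
by apply/diff_locallyP; rewrite (diff_unique dc gE).
Qed.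

Lemma is_derive_mulr (f g : V -> R) x v df dg :
  is_derive x v f df -> is_derive x v g dg ->
  is_derive x v (fun t => f t * g t) (df * g x + f x * dg).
Proof.
move=> dfx dgx; have := is_deriveM dfx dgx.
by move/is_derive_eq; apply; rewrite /GRing.scale/= addrC mulrC.
Qed.

Lemma is_derive_sumr {W : normedModType R} n (f : 'I_n -> V -> W) x v df :
  (forall i, is_derive x v (f i) (df i)) ->
  is_derive x v (fun t => \sum_i f i t) (\sum_i df i).
Proof.
move=> dfx; rewrite (_ : (fun t => _) = \sum_(i < n) f i).
  exact: is_derive_sum.
by apply/funext => t; rewrite fct_sumE.
Qed.

Lemma is_derive_coord {m k} (f : V -> 'M[R]_(m, k)) x v df i j :
  is_derive x v f df -> is_derive x v (fun t => f t i j) (df i j).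
Proof.
move=> [dfx <-]; split; first exact: (derivable_mxP _ _ _).1.
by rewrite derive_mx// mxE.
Qed.

Lemma is_derive_dotr {m} (f g : V -> 'rV[R]_m) x v df dg :
  is_derive x v f df -> is_derive x v g dg ->
  is_derive x v (fun t => dotr (f t) (g t)) (dotr df (g x) + dotr (f x) dg).
Proof.
move=> dfx dgx; rewrite -big_split /=.
apply: is_derive_sumr => i.
by apply: is_derive_mulr; exact: is_derive_coord.
Qed.

Lemma is_derive_line {W : normedModType R} (f : V -> W) x v (t : R) d :
  is_derive (t *: v + x) v f d -> is_derive t (1 : R) (fun s => f (s *: v + x)) d.
Proof.
move=> [df <-].
have E : (fun h : R => h^-1 *: (((fun s => f (s *: v + x)) \o shift t) (h *: 1) -
      f (t *: v + x))) =
    (fun h => h^-1 *: ((f \o shift (t *: v + x)) (h *: v) - f (t *: v + x))).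
  by apply/funext => h /=; rewrite [h *: 1]mulr1 scalerDl addrA.
by split; rewrite /derivable /derive /= E.
Qed.

Lemma derive_scale {W : normedModType R} (f : V -> W) x v c :
  differentiable f x -> 'D_(c *: v) f x = c *: 'D_v f x.
Proof. by move=> df; rewrite !deriveE// linearZ. Qed.

Lemma derive_add {W : normedModType R} (f : V -> W) x v w :
  differentiable f x -> 'D_(v + w) f x = 'D_v f x + 'D_w f x.
Proof. by move=> df; rewrite !deriveE// linearD. Qed.

Lemma derive_sum_dir {W : normedModType R} (I : finType) (f : V -> W) x (v : I -> V) :
  differentiable f x -> 'D_(\sum_i v i) f x = \sum_i 'D_(v i) f x.
Proof.
move=> df; rewrite deriveE// linear_sum; apply: eq_bigr => i _.
by rewrite deriveE.
Qed.

Lemma derive_chain {U W : normedModType R} (t : U -> V) (f : V -> W) x v :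
  differentiable t x -> differentiable f (t x) ->
  'D_v (f \o t) x = 'D_('D_v t x) f (t x).
Proof.
move=> dt df; rewrite (deriveE _ (differentiable_comp dt df)) (diff_comp dt df) /=.
by rewrite (deriveE _ dt) (deriveE _ df).
Qed.

Lemma mean_value_line (f : V -> R) x v :
  (forall t : R, 0 <= t <= 1 -> differentiable f (t *: v + x)) ->
  exists2 t, 0 < t < 1 & f (v + x) - f x = 'D_v f (t *: v + x).
Proof.
move=> df.
have dl (t : R) : 0 <= t <= 1 ->
    is_derive t (1 : R) (fun s => f (s *: v + x)) ('D_v f (t *: v + x)).
  by move=> t01; apply/is_derive_line/derivableP/diff_derivable/df.
have [|||t] := @MVT R (fun s => f (s *: v + x)) (fun t => 'D_v f (t *: v + x)) 0 1.
- exact: ltr01.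
- by move=> t; rewrite in_itv/= => /andP[t0 t1]; apply: dl; rewrite !ltW.
- apply: derivable_within_continuous => t; rewrite in_itv/= => t01.
  by have [] := dl t t01.
rewrite in_itv/= => /andP[t0 t1]; rewrite subr0 mulr1 scale1r scale0r add0r => E.
by exists t; rewrite ?t0 ?t1.
Qed.

Lemma cvg_line (x v : V) : (fun h : R => h *: v + x) @ (0 : R) --> x.
Proof.
rewrite -[X in _ --> X]add0r -(scale0r v).
by apply: cvgD; [apply: cvgZr_tmp; exact: cvg_id|exact: cvg_cst].
Qed.

Lemma near_line (P : set V) (x v : V) : nbhs x P ->
  exists2 e : R, 0 < e & forall h : R, `|h| < e -> P (h *: v + x).
Proof.
move=> /(cvg_line v)/nbhs_ballP[e /= e0 he].
by exists e => // h hh; apply: he; rewrite /ball/= sub0r normrN.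
Qed.

Lemma derive_gt0_increasing (f : V -> R) x v :
  derivable f x v -> 0 < 'D_v f x ->
  exists2 e : R, 0 < e & forall h : R, 0 < h < e -> f x < f (h *: v + x).
Proof.
move=> df D0.
have /cvgrPdist_lt/(_ _ D0)/nbhs_ballP[e /= e0 he] := df.
exists e => // h /andP[h0 he'].
have := he h; rewrite /ball/= sub0r normrN gtr0_norm// => /(_ he' (lt0r_neq0 h0)).
rewrite -/('D_v f x) => /(le_lt_trans (ler_norm _)).
rewrite ltrBlDr ltrDl /GRing.scale/= pmulr_rgt0 ?invr_gt0// subr_gt0.
by [].
Qed.

Lemma derive_local_max (f : V -> R) x v :
  differentiable f x -> (\forall y \near x, f y <= f x) -> 'D_v f x = 0.
Proof.
move=> df fmax.
have D_le0 w : 'D_w f x <= 0.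
  rewrite leNgt; apply/negP => /(derive_gt0_increasing (diff_derivable df))[e e0 he].
  have [e' e'0 he'] := near_line w fmax.
  pose h := Num.min e e' / 2.
  have h0 : 0 < Num.min e e' by rewrite lt_min e0.
  have hlt : h < Num.min e e' by rewrite ltr_pdivrMr// ltr_pMr// ltr1n.
  have := hlt; rewrite lt_min => /andP[h1 h2].
  have hp : 0 < h by rewrite divr_gt0.
  have := he h; rewrite hp h1 => /(_ isT); apply/negP; rewrite -leNgt.
  by apply: he'; rewrite gtr0_norm.
apply/le_anti; rewrite D_le0/= -oppr_le0 -scaleN1r -derive_scale//.
Qed.

(** Were the second derivative positive, the first would be positive just
    after the maximum, contradicting the mean value theorem. *)
Lemma derive2_local_max (f : V -> R) x v :
  (\forall y \near x, differentiable f y) -> derivable ('D_v f) x v ->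
  (\forall y \near x, f y <= f x) -> 'D_v ('D_v f) x <= 0.
Proof.
move=> df d2f fmax.
have Df0 := derive_local_max v (nbhs_singleton df) fmax.
rewrite leNgt; apply/negP => /(derive_gt0_increasing d2f)[e e0 he].
have [e' e'0 he'] := near_line v (filterI df fmax).
have m0 : 0 < Num.min e e' by rewrite lt_min e0.
pose h := Num.min e e' / 2.
have hlt : h < Num.min e e' by rewrite ltr_pdivrMr// ltr_pMr// ltr1n.
have := hlt; rewrite lt_min => /andP[h1 h2].
have hp : 0 < h by rewrite divr_gt0.
have [|t /andP[t0 t1]] := @mean_value_line f x (h *: v).
  move=> t /andP[t0 t1]; rewrite scalerA; apply: (he' _ _).1.
  by rewrite normrM (gtr0_norm hp) ger0_norm//; nra.
rewrite scalerA derive_scale; last first.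
  by apply: (he' _ _).1; rewrite normrM (gtr0_norm hp) gtr0_norm//; nra.
have th : 0 < t * h < e by apply/andP; split; nra.
have := he _ th; rewrite Df0 => Dpos E.
have : f (h *: v + x) <= f x by apply: (he' _ _).2; rewrite gtr0_norm.
by rewrite -subr_le0 E leNgt mulr_gt0.
Qed.

Lemma derive_translate {W : normedModType R} (f : V -> W) (y v w : V) :
  'D_v (fun z => f (z + w)) y = 'D_v f (y + w).
Proof.
rewrite /derive (_ : (fun h : R => _) =
  (fun h : R => h^-1 *: ((f \o shift (y + w)) (h *: v) - f (y + w)))) //.
by apply/funext => h /=; rewrite addrA.
Qed.

Lemma differentiable_translate {W : normedModType R} (f : V -> W) (y w : V) :
  differentiable f (y + w) -> differentiable (fun z => f (z + w)) y.
Proof. by move=> df; apply: (@differentiable_comp _ _ _ _ (fun z => z + w) f). Qed.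

(** The second difference is a value of the mixed derivative, by two
    applications of the mean value theorem. *)
Lemma second_difference (f : V -> R) (v w x : V) (h : R) (P : set V) :
  (forall s t : R, 0 <= s <= 1 -> 0 <= t <= 1 ->
    P (t *: (h *: w) + (s *: (h *: v) + x))) ->
  (forall y, P y -> differentiable f y /\ differentiable ('D_v f) y) ->
  exists2 y, P y &
    f (h *: w + (h *: v + x)) - f (h *: w + x) - f (h *: v + x) + f x =
    h * (h * 'D_w ('D_v f) y).
Proof.
move=> Pbox df.
have i01 (t : R) : 0 < t < 1 -> 0 <= t <= 1.
  by case/andP => ? ?; rewrite !ltW.
have P0 (s : R) : 0 <= s <= 1 -> P (s *: (h *: v) + x).
  move=> s01; have := Pbox s 0 s01; rewrite scale0r add0r; apply.
  by rewrite lexx ler01.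
have P1 (s : R) : 0 <= s <= 1 -> P (s *: (h *: v) + x + h *: w).
  move=> s01; have := Pbox s 1 s01; rewrite scale1r addrC; apply.
  by rewrite lexx ler01.
have dg (t : R) : 0 <= t <= 1 ->
    differentiable (fun y => f (y + h *: w) - f y) (t *: (h *: v) + x).
  move=> t01; apply: differentiableB; last exact: (df _ (P0 t t01)).1.
  exact: differentiable_translate (df _ (P1 t t01)).1.
have [t t01] := mean_value_line dg.
rewrite derive_scale; last exact/dg/i01.
rewrite deriveB; last 2 first.
  exact/diff_derivable/differentiable_translate/(df _ (P1 t (i01 _ t01))).1.
  exact/diff_derivable/(df _ (P0 t (i01 _ t01))).1.
rewrite derive_translate => E1.
have dg' (s : R) : 0 <= s <= 1 ->
    differentiable ('D_v f) (s *: (h *: w) + (t *: (h *: v) + x)).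
  by move=> s01; exact: (df _ (Pbox t s (i01 _ t01) s01)).2.
have [s s01] := mean_value_line dg'.
rewrite derive_scale; last exact/dg'/i01.
move=> E2; exists (s *: (h *: w) + (t *: (h *: v) + x)).
  exact: (Pbox t s (i01 _ t01) (i01 _ s01)).
have {}E2 : h * 'D_w ('D_v f) (s *: (h *: w) + (t *: (h *: v) + x)) =
   'D_v f (t *: (h *: v) + x + h *: w) - 'D_v f (t *: (h *: v) + x).
  by rewrite [_ + h *: w]addrC E2.
have {}E1 : h * ('D_v f (t *: (h *: v) + x + h *: w) - 'D_v f (t *: (h *: v) + x)) =
    f (h *: v + x + h *: w) - f (h *: v + x) - (f (x + h *: w) - f x).
  by rewrite E1.
rewrite E2 E1 ![h *: w + _]addrC; ring.
Qed.

(** Schwarz: both mixed derivatives, at points close to [x], equal the same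
    second difference divided by [h ^+ 2]. *)
Lemma derive_derive_sym (f : V -> R) (x v w : V) :
  (\forall y \near x, [/\ differentiable f y, differentiable ('D_v f) y
      & differentiable ('D_w f) y]) ->
  {for x, continuous ('D_w ('D_v f))} -> {for x, continuous ('D_v ('D_w f))} ->
  'D_w ('D_v f) x = 'D_v ('D_w f) x.
Proof.
move=> df cwv cvw; apply/eqP; rewrite -subr_eq0; apply/negPn/negP => ne0.
set a := 'D_w ('D_v f) x in ne0 *; set b := 'D_v ('D_w f) x in ne0 *.
pose e := `|a - b| / 2.
have e0 : 0 < e by rewrite divr_gt0// normr_gt0.
pose P y := [/\ differentiable f y, differentiable ('D_v f) y
      & differentiable ('D_w f) y] /\
  (`|a - 'D_w ('D_v f) y| < e /\ `|b - 'D_v ('D_w f) y| < e).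
have : nbhs x P.
  apply: filterI => //; apply: filterI.
  - exact: (cvgrPdist_lt _ _).1 cwv _ e0.
  - exact: (cvgrPdist_lt _ _).1 cvw _ e0.
move=> /nbhs_ballP[d /= d0 dP].
pose h := d / (`|v| + `|w| + 1).
have n1 : 0 < `|v| + `|w| + 1 by rewrite ltr_wpDl// addr_ge0.
have h0 : 0 < h by rewrite divr_gt0.
have hd : h * (`|v| + `|w|) < d.
  have : h * (`|v| + `|w| + 1) = d by rewrite divfK// gt_eqF.
  by rewrite mulrDr mulr1 => <-; rewrite ltrDl.
clearbody h.
have box (s t : R) : 0 <= s <= 1 -> 0 <= t <= 1 ->
    P (t *: (h *: w) + (s *: (h *: v) + x)).
  move=> /andP[s0 s1] /andP[t0 t1]; apply: dP.
  rewrite -ball_normE /= distrC addrA addrK.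
  apply: le_lt_trans (ler_normD _ _) _.
  rewrite !normrZ (ger0_norm t0) (ger0_norm s0) (gtr0_norm h0).
  apply: le_lt_trans hd; rewrite mulrDr addrC; apply: lerD.
    by rewrite ler_piMl// mulr_ge0// ltW.
  by rewrite ler_piMl// mulr_ge0// ltW.
have [||y [_ [ay _]] E1] := @second_difference f v w x h P.
- exact: box.
- by move=> y [[]].
have [||z [_ [_ bz]] E2] := @second_difference f w v x h P.
- by move=> s t s01 t01; rewrite addrCA; exact: box.
- by move=> z [[]].
have Eyz : 'D_w ('D_v f) y = 'D_v ('D_w f) z.
  apply: (mulfI (lt0r_neq0 h0)); apply: (mulfI (lt0r_neq0 h0)).
  apply: etrans (esym E1) (etrans _ E2).
  rewrite (addrCA (h *: v) (h *: w) x). congr (_ + _). exact: addrAC.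
have ab : `|a - b| < e + e.
  have -> : a - b = (a - 'D_w ('D_v f) y) - (b - 'D_v ('D_w f) z).
    by rewrite Eyz opprB addrA subrK.
  exact: le_lt_trans (ler_normB _ _) (ltrD ay bz).
by move: ab; rewrite -splitr ltxx.
Qed.

End DirectionalDerivatives.

(** * Functions of class C^k, and the derivative of a determinant *)

Section ClassCk.
Context {R : realType} {V : normedModType R}.
Variable U : set V.
Hypothesis U_open : open U.

Lemma near_open {P : set V} x : U x -> (forall y, U y -> P y) -> \forall y \near x, P y.
Proof. by move=> Ux UP; apply: filterS (open_nbhs_nbhs (conj U_open Ux)). Qed.

Lemma Ck_eq {W : normedModType R} k (f g : V -> W) :
  (forall x, U x -> f x = g x) -> Ck k U f -> Ck k U g.
Proof.
elim: k f g => [|k IH] f g fg /=.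
  move=> cf x Ux; have : g @ x --> f x.
    by apply: cvg_trans (cf x Ux); apply: near_eq_cvg; exact: near_open.
  by rewrite (fg x Ux).
move=> [df Df]; split=> [x Ux|v].
  exact: near_eq_differentiable (near_open Ux fg) (df x Ux).
apply: IH (Df v) => x Ux; apply: near_eq_derive; exact: near_open.
Qed.

Lemma CkW {W : normedModType R} k (f : V -> W) : Ck k.+1 U f -> Ck k U f.
Proof.
elim: k f => [|k IH] f [df Df].
  by move=> x Ux; exact/differentiable_continuous/df.
by split => // v; exact: IH (Df v).
Qed.

Lemma Ck_cst {W : normedModType R} k (c : W) : Ck k U (fun=> c).
Proof.
elim: k c => [|k IH] c /=; first by move=> x _; exact: cst_continuous.
split=> [x _|v]; first exact: differentiable_cst.
by apply: Ck_eq (IH 0) => x _; rewrite derive_cst.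
Qed.

Lemma CkD {W : normedModType R} k (f g : V -> W) :
  Ck k U f -> Ck k U g -> Ck k U (fun x => f x + g x).
Proof.
elim: k f g => [|k IH] f g /=.
  by move=> cf cg x Ux; apply: cvgD; [exact: cf|exact: cg].
move=> [df Df] [dg Dg]; split=> [x Ux|v].
  by apply: differentiableD; [exact: df|exact: dg].
apply: Ck_eq (IH _ _ (Df v) (Dg v)) => x Ux.
by rewrite deriveD//; apply: diff_derivable; [exact: df|exact: dg].
Qed.

Lemma CkM k (f g : V -> R) :
  Ck k U f -> Ck k U g -> Ck k U (fun x => f x * g x).
Proof.
elim: k f g => [|k IH] f g.
  by move=> cf cg x Ux; apply: cvgM; [exact: cf|exact: cg].
move=> Cf Cg; have [df Df] := Cf; have [dg Dg] := Cg; split=> [x Ux|v].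
  by apply: differentiableM; [exact: df|exact: dg].
apply: Ck_eq (CkD (IH _ _ (Df v) (CkW Cg)) (IH _ _ (CkW Cf) (Dg v))) => x Ux.
apply/esym/derive_val/is_derive_mulr; apply/derivableP/diff_derivable.
  exact: df.
exact: dg.
Qed.

Lemma Ck_sum {W : normedModType R} k (I : Type) (r : seq I) (f : I -> V -> W) :
  (forall i, Ck k U (f i)) -> Ck k U (fun x => \sum_(i <- r) f i x).
Proof.
move=> Cf; elim: r => [|i r IH].
  by apply: Ck_eq (Ck_cst k 0) => x _; rewrite big_nil.
by apply: Ck_eq (CkD (Cf i) IH) => x _; rewrite big_cons.
Qed.

Lemma Ck_prod k (I : Type) (r : seq I) (f : I -> V -> R) :
  (forall i, Ck k U (f i)) -> Ck k U (fun x => \prod_(i <- r) f i x).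
Proof.
move=> Cf; elim: r => [|i r IH].
  by apply: Ck_eq (Ck_cst k (1 : R)) => x _; rewrite big_nil.
by apply: Ck_eq (CkM (Cf i) IH) => x _; rewrite big_cons.
Qed.

Lemma CkV k (f : V -> R) : (forall x, U x -> f x != 0) ->
  Ck k U f -> Ck k U (fun x => (f x)^-1).
Proof.
move=> f0; elim: k => [|k IH] Cf.
  by move=> x Ux; apply: cvgV; [exact: f0|exact: Cf].
have [df Df] := Cf; split=> [x Ux|v].
  by apply: differentiableV; [exact: df|exact: f0].
have CfV := IH (CkW Cf).
apply: Ck_eq (CkM (CkM (Ck_cst _ (-1 : R)) (CkM CfV CfV)) (Df v)) => x Ux.
rewrite deriveV ?f0//; last exact/diff_derivable/df.
by rewrite /GRing.scale/= mulN1r expr2 invfM.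
Qed.

Lemma Ck_sqrt k (f : V -> R) : (forall x, U x -> 0 < f x) ->
  Ck k U f -> Ck k U (fun x => Num.sqrt (f x)).
Proof.
move=> f0; elim: k => [|k IH] Cf.
  move=> x Ux; apply: (cvg_comp f Num.sqrt (Cf x Ux)); exact: sqrt_continuous.
have [df Df] := Cf.
have ds x : U x -> differentiable (Num.sqrt : R -> R) (f x).
  by move=> Ux; apply/derivable1_diffP; have [] := is_derive1_sqrt (f0 x Ux).
split=> [x Ux|v].
  by apply: (@differentiable_comp _ _ _ _ f); [exact: df|exact: ds].
have s0 x : U x -> 2 * Num.sqrt (f x) != 0.
  by move=> Ux; rewrite mulf_neq0// gt_eqF// sqrtr_gt0 f0.
have := @CkV k (fun x => 2 * Num.sqrt (f x)) s0.
move=> /(_ (CkM (Ck_cst _ (2 : R)) (IH (CkW Cf)))) CV.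
apply: Ck_eq (CkM CV (Df v)) => x Ux.
rewrite (derive_chain v (df x Ux) (ds x Ux)).
have := derive_scale (1 : R) ('D_v f x) (ds x Ux).
by rewrite [_ *: 1]mulr1 => ->; rewrite derive_sqrt ?f0// mulrC.
Qed.

Lemma CkZl {W : normedModType R} k (f : V -> R) (w : W) :
  Ck k U f -> Ck k U (fun x => f x *: w).
Proof.
elim: k f => [|k IH] f.
  by move=> Cf x Ux; apply: cvgZr_tmp; exact: Cf.
move=> [df Df]; split=> [x Ux|v]; first exact/differentiableZl/df.
apply: Ck_eq (IH _ (Df v)) => x Ux.
rewrite (deriveE v (df x Ux)) (deriveE v (differentiableZl w (df x Ux))).
by rewrite (diffZl w (df x Ux)).
Qed.

Lemma Ck_coord k {m p} (f : V -> 'M[R]_(m, p)) i j :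
  Ck k U f -> Ck k U (fun x => f x i j).
Proof.
elim: k f => [|k IH] f.
  by move=> Cf x Ux; apply: cvg_coord; exact: Cf.
move=> [df Df]; split=> [x Ux|v].
  exact: (differentiable_comp (df x Ux) (differentiable_coord _ i j)).
apply: Ck_eq (IH _ (Df v)) => x Ux; apply/esym/derive_val.
exact/is_derive_coord/derivableP/diff_derivable/df.
Qed.

Lemma Ck_row k {m} (f : V -> 'rV[R]_m) :
  (forall j, Ck k U (fun x => f x 0 j)) -> Ck k U f.
Proof.
move=> Cf; apply: Ck_eq (Ck_sum (index_enum 'I_m) (fun j => CkZl (delta_mx 0 j) (Cf j))).
by move=> x _; rewrite [RHS]row_sum_delta.
Qed.

Lemma Ck_dotr k {m} (f g : V -> 'rV[R]_m) :
  Ck k U f -> Ck k U g -> Ck k U (fun x => dotr (f x) (g x)).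
Proof.
by move=> Cf Cg; apply: Ck_sum => j; apply: CkM; exact: Ck_coord.
Qed.

Lemma Ck_det k {m} (f : V -> 'M[R]_m) :
  (forall i j, Ck k U (fun x => f x i j)) -> Ck k U (fun x => \det (f x)).
Proof.
by move=> Cf; apply: Ck_sum => s; apply: CkM; [exact: Ck_cst|exact: Ck_prod].
Qed.

Lemma Ck_derive_sym {m} (f : V -> 'rV[R]_m) x v w :
  Ck 2 U f -> U x -> 'D_w ('D_v f) x = 'D_v ('D_w f) x.
Proof.
move=> Cf Ux; have [df Df] := Cf.
have D1 u y : U y -> differentiable ('D_u f) y by move=> Uy; exact: (Df u).1.
have E u j y : U y -> 'D_u f y 0 j = 'D_u (fun z => f z 0 j) y.
  move=> Uy; apply/esym/derive_val.
  exact/is_derive_coord/derivableP/diff_derivable/df.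
have E2 u u' j y : U y ->
    'D_u' ('D_u f) y 0 j = 'D_u' ('D_u (fun z => f z 0 j)) y.
  move=> Uy; rewrite -(near_eq_derive _ (near_open Uy (E u j))).
  by apply/esym/derive_val/is_derive_coord/derivableP/diff_derivable/D1.
apply/rowP => j; apply: etrans (E2 v w j x Ux) (etrans _ (esym (E2 w v j x Ux))).
have Cj := Ck_coord 0 j Cf.
apply: derive_derive_sym.
- apply: (near_open Ux) => y Uy; split; first exact: Cj.1.
    exact: (Cj.2 v).1.
  exact: (Cj.2 w).1.
- exact: (Cj.2 v).2.
- exact: (Cj.2 w).2.
Qed.

End ClassCk.

Lemma Ck_subset {R : realType} {V W : normedModType R} (A U : set V) k (f : V -> W) :
  A `<=` U -> Ck k U f -> Ck k A f.
Proof.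
move=> AU; elim: k f => [|k IH] f /=; first by move=> Cf x /AU; exact: Cf.
by move=> [df Df]; split=> [x /AU|v]; [exact: df|exact: IH].
Qed.

Section DeterminantDerivative.
Context {R : realType} {V : normedModType R}.

Lemma is_derive_prod n (f : 'I_n -> V -> R) x v (df : 'I_n -> R) :
  (forall i, is_derive x v (f i) (df i)) ->
  is_derive x v (fun t => \prod_i f i t)
    (\sum_i df i * \prod_(j | j != i) f j x).
Proof.
elim: n f df => [|n IH] f df dfx.
  rewrite (_ : (fun t => _) = cst 1); last by apply/funext => t; rewrite big_ord0.
  by rewrite big_ord0; exact: is_derive_cst.
rewrite (_ : (fun t => _) =
    (fun t => f ord0 t * \prod_i f (lift ord0 i) t)); last first.
  by apply/funext => t; rewrite big_ord_recl.
have := is_derive_mulr (dfx ord0) (IH _ _ (fun i => dfx (lift ord0 i))).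
move/is_derive_eq; apply; rewrite big_ord_recl; congr (_ * _ + _).
  by rewrite [RHS]big_mkcond big_ord_recl /= mul1r.
rewrite mulr_sumr; apply: eq_bigr => i _; rewrite mulrCA; congr (_ * _).
rewrite [RHS]big_mkcond big_ord_recl /= [in LHS]big_mkcond; congr (_ * _).
Qed.

(** Jacobi's formula where the matrix is diagonal: off the diagonal the
    cofactors vanish. *)
Lemma is_derive_det_diag n (A : V -> 'M[R]_n) x v (dA : 'M[R]_n) (d : 'I_n -> R) :
  (forall i j, is_derive x v (fun t => A t i j) (dA i j)) ->
  (forall i j, A x i j = d i * (i == j)%:R) ->
  is_derive x v (fun t => \det (A t)) (\sum_i dA i i * \prod_(j | j != i) d j).
Proof.
move=> dAx Ax.
pose D (s : 'S_n) := (-1) ^+ s *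
  \sum_i dA i (s i) * \prod_(j | j != i) A x j (s j).
have dS (s : 'S_n) : is_derive x v (fun t => (-1) ^+ s * \prod_i A t i (s i)) (D s).
  have := is_derive_mulr (is_derive_cst ((-1) ^+ s : R) x v)
    (is_derive_prod (fun i => dAx i (s i))).
  by move/is_derive_eq; apply; rewrite mul0r add0r.
rewrite /determinant (_ : (fun t => _) =
  \sum_(s : 'S_n) (fun t => (-1) ^+ s * \prod_i A t i (s i))); last first.
  by apply/funext => t; rewrite fct_sumE.
have : is_derive x v (\sum_(s : 'S_n) (fun t => (-1) ^+ s * \prod_i A t i (s i)))
    (\sum_(s : 'S_n) D s).
  elim/big_ind2: _ => [|f df g dg|s _] //; first exact: is_derive_cst.
  exact: is_deriveD.
move/is_derive_eq; apply.
rewrite (bigD1 1%g)//= [X in _ + X]big1 ?addr0.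
  rewrite /D odd_perm1 expr0 mul1r; apply: eq_bigr => i _; rewrite perm1.
  by congr (_ * _); apply: eq_bigr => j _; rewrite perm1 Ax eqxx mulr1.
move=> s s1; rewrite /D big1 ?mulr0// => i _.
have [j ji sj] : exists2 j, j != i & s j != j.
  apply: contrapT => nex; have sid j : j != i -> s j = j.
    by move=> ji; apply/eqP/negPn/negP => sj; apply: nex; exists j.
  case/negP: s1; apply/eqP/permP => j; rewrite perm1.
  have [->|/sid//] := eqVneq j i.
  have [//|si] := eqVneq (s i) i.
  by have := sid _ si => /perm_inj.
by rewrite (bigD1 j)//= Ax eq_sym (negPf sj) mulr0 mul0r mulr0.
Qed.

End DeterminantDerivative.

(** * The unit normal is smooth *)

Lemma nbhs_open {T : topologicalType} (x : T) (P : set T) : nbhs x P ->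
  exists2 A : set T, open A /\ A x & A `<=` P.
Proof. by rewrite nbhsE. Qed.

(** Used for the normal, which is given by a formula only near each point,
    with a sign that may depend on the point. *)
Lemma Ck_local {R : realType} {V W : normedModType R} k (U : set V) (f : V -> W) :
  (forall x, U x -> exists2 A : set V, A x & Ck k A f) -> Ck k U f.
Proof.
elim: k f => [|k IH] f loc.
  by move=> x /loc[A Ax]; apply.
split=> [x /loc[A Ax [df _]]|v]; first exact: df.
by apply: IH => x /loc[A Ax [_ Df]]; exists A => //; exact: Df.
Qed.

(** The principal curvatures are specified by the characteristic polynomial
    of the shape operator; an eigenbasis is what computes it. *)
Lemma char_poly_eigenbasis {R : realType} n (A E : 'M[R]_n) (d : 'I_n -> R) :
  E \in unitmx -> (forall j, row j E *m A = d j *: row j E) ->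
  char_poly A = \prod_j ('X - (d j)%:P).
Proof.
move=> uE EA; pose D := diag_mx (\row_j d j).
have ED : E *m A = D *m E.
  apply/row_matrixP => j; rewrite row_mul EA; apply/rowP => l.
  by rewrite /D mul_diag_mx !mxE.
have : \det (map_mx polyC E) * \det (char_poly_mx A) =
    \det (char_poly_mx D) * \det (map_mx polyC E).
  rewrite -!det_mulmx; congr (\det _).
  rewrite /char_poly_mx mulmxBr mulmxBl -!map_mxM ED.
  by rewrite mul_scalar_mx mul_mx_scalar.
rewrite mulrC => /mulIf detE; rewrite -[LHS]/(\det (char_poly_mx A)) detE; last first.
  by rewrite det_map_mx polyC_eq0 -unitfE -unitmxE.
rewrite -/(char_poly D) char_poly_trig ?diag_mx_is_trig//.
by apply: eq_bigr => j _; rewrite !mxE eqxx mulr1n.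
Qed.

Section Hypersurface.
Context {R : realType} {n : nat} {M : topologicalType}.
Context {S : smooth_atlas R n M} {g : riemannian_metric S}.
Context {X N : M -> 'rV[R]_n.+1}.
Hypothesis X_isometric : isometric_immersion g X.
Hypothesis N_normal : unit_normal_field S X N.

Local Notation x i := (X \o param i).
Local Notation nu i := (N \o param i).
Implicit Types (i : chart S) (u v w : 'rV[R]_n).

Lemma position_smooth i k : Ck k (cod i) (x i).
Proof. exact: X_isometric.1. Qed.

Lemma position_differentiable i u : cod i u -> differentiable (x i) u.
Proof. by move=> iu; exact: (position_smooth i 1).1. Qed.

Lemma near_cod (i : chart S) u : cod i u -> nbhs u (cod i).
Proof. by move=> iu; apply: open_nbhs_nbhs; split => //; exact: cod_open. Qed.

Lemma metricE i u v w : cod i u ->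
  dotr ('D_v (x i) u) ('D_w (x i) u) = bform (gmx g i u) v w.
Proof. exact: X_isometric.2. Qed.

Lemma normal_unit i u : dotr (nu i u) (nu i u) = 1.
Proof. by case: N_normal => _ ->. Qed.

Lemma tangent_normal i u v : cod i u -> dotr ('D_v (x i) u) (nu i u) = 0.
Proof. by case: N_normal => _ _; apply. Qed.

Lemma immersion_injective i u v : cod i u -> 'D_v (x i) u = 0 -> v = 0.
Proof.
move=> iu v0; apply/eqP/negPn/negP => /(gmx_pos g iu).
by rewrite -metricE// v0 dotr0l ltxx.
Qed.

Lemma position_derive_sum i u (I : finType) (c : I -> R) (e : I -> 'rV[R]_n) : cod i u ->
  'D_(\sum_j c j *: e j) (x i) u = \sum_j c j *: 'D_(e j) (x i) u.
Proof.
move=> iu; have dx := position_differentiable iu.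
by rewrite derive_sum_dir//; apply: eq_bigr => j _; rewrite derive_scale.
Qed.

(** The rows are [xi] and the coordinate tangent vectors; its first row of
    cofactors is the vector product of the coordinate tangent vectors. *)
Definition frame_mx i (u : 'rV[R]_n) (xi : 'rV[R]_n.+1) : 'M[R]_n.+1 :=
  \matrix_(j < n.+1)
    (if unlift ord0 j is Some j' then 'D_(delta_mx 0 j') (x i) u else xi).

Definition vector_product i u : 'rV[R]_n.+1 :=
  \row_l cofactor (frame_mx i u 0) ord0 l.

Lemma row0_frame_mx i u xi : row ord0 (frame_mx i u xi) = xi.
Proof. by rewrite rowK unlift_none. Qed.

Lemma row_frame_mx i u xi j :
  row (lift ord0 j) (frame_mx i u xi) = 'D_(delta_mx 0 j) (x i) u.
Proof. by rewrite rowK liftK. Qed.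

Lemma dotr_vector_product i u xi :
  dotr xi (vector_product i u) = \det (frame_mx i u xi).
Proof.
rewrite (expand_det_row _ ord0); apply: eq_bigr => l _.
rewrite [vector_product _ _ _ _]mxE; congr (_ * _).
  by rewrite -{1}(row0_frame_mx i u xi) mxE.
rewrite /cofactor; congr (_ * \det _).
by apply/matrixP => a b; rewrite !mxE liftK.
Qed.

Lemma vector_product_tangent i u v : cod i u ->
  dotr ('D_v (x i) u) (vector_product i u) = 0.
Proof.
move=> iu; rewrite [v]row_sum_delta position_derive_sum// dotr_suml big1// => j _.
rewrite dotrZl dotr_vector_product (determinant_alternate (neq_lift ord0 j)) ?mulr0//.
move=> l; have := row0_frame_mx i u ('D_(delta_mx 0 j) (x i) u).
rewrite -{2}(row_frame_mx i u ('D_(delta_mx 0 j) (x i) u) j) => /rowP/(_ l).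
by rewrite !mxE.
Qed.

Lemma det_frame_normal_neq0 i u : cod i u -> \det (frame_mx i u (nu i u)) != 0.
Proof.
move=> iu; apply/det0P => -[w w0].
rewrite mulmx_sum_row big_ord_recl row0_frame_mx.
under eq_bigr do rewrite row_frame_mx.
rewrite -position_derive_sum// => wE.
have w00 : w 0 ord0 = 0.
  have := congr1 (fun y => dotr y (nu i u)) wE.
  by rewrite dotrDl dotrZl normal_unit tangent_normal// dotr0l mulr1 addr0.
move: wE; rewrite w00 scale0r add0r => /(immersion_injective iu)/rowP wl.
case/negP: w0; apply/eqP/rowP => j; rewrite [RHS]mxE.
have [j' ->|->//] := unliftP ord0 j.
have := wl j'; rewrite [RHS]mxE summxE (bigD1 j')//= big1 ?addr0.
  by rewrite !mxE !eqxx mulr1.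
by move=> l lj; rewrite !mxE eqxx eq_sym (negPf lj) mulr0.
Qed.

(** The vector product is orthogonal to the tangent vectors, and these together
    with the normal are independent. *)
Lemma vector_productE i u : cod i u ->
  vector_product i u = dotr (vector_product i u) (nu i u) *: nu i u.
Proof.
move=> iu; set c := vector_product i u; apply/eqP; rewrite -subr_eq0; apply/eqP.
have uB : frame_mx i u (nu i u) \in unitmx.
  by rewrite unitmxE unitfE det_frame_normal_neq0.
apply: (can_inj (@trmxK _ _ _)); apply: (can_inj (mulKmx uB)).
rewrite trmx0 mulmx0; apply/row_matrixP => j; rewrite row_mul row0.
apply/matrixP => a b; rewrite !ord1 -dotr_mx [RHS]mxE dotrBr dotrZr.
have [j' ->|->] := unliftP ord0 j.
  by rewrite row_frame_mx vector_product_tangent// tangent_normal// mulr0 subrr.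
by rewrite row0_frame_mx normal_unit mulr1 dotrC subrr.
Qed.

Lemma vector_product_smooth i k : Ck k (cod i) (vector_product i).
Proof.
have op := @cod_open _ _ _ S i.
apply: (Ck_row op) => l.
suff Cd : Ck k (cod i) (fun u => \det (row' ord0 (col' l (frame_mx i u 0)))).
  apply: (Ck_eq op _ (CkM op (Ck_cst op k ((-1) ^+ (@ord0 n + l)%N : R)) Cd)) => u iu.
  by rewrite [RHS]mxE.
apply: (Ck_det op) => a b.
have Cx := Ck_coord op 0 (lift l b) ((position_smooth i k.+1).2 (delta_mx 0 a)).
apply: (Ck_eq op _ Cx) => u iu.
by rewrite !mxE liftK.
Qed.

(** The normal is assumed continuous only. It is the vector product divided by
    its length, up to a sign, and continuity makes the sign locally constant. *)
Lemma normal_smooth i k : Ck k (cod i) (nu i).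
Proof.
apply: Ck_local => u iu.
pose s v := dotr (vector_product i v) (nu i v).
have s2 v : cod i v -> dotr (vector_product i v) (vector_product i v) = s v ^+ 2.
  by move=> iv; rewrite {2}vector_productE// dotrZr expr2.
have su : s u != 0.
  by rewrite /s dotrC dotr_vector_product det_frame_normal_neq0.
have cs : s @ u --> s u.
  apply: (@cvg_dotr _ _ (nbhs u) _ _ (vector_product i) (nu i)).
    exact: (vector_product_smooth i 0 u iu).
  apply: continuous_comp; first exact: param_continuous.
  by case: N_normal => cN _ _; exact: cN.
have sg : \forall v \near u, Num.sg (s v) = Num.sg (s u).
  have [s0|s0|s0] := ltgtP (s u) 0; last by rewrite s0 eqxx in su.
    by apply: filterS ((cvgr_lt _ cs) _ s0) => v /ltr0_sg ->; rewrite ltr0_sg.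
  by apply: filterS ((cvgr_gt _ cs) _ s0) => v /gtr0_sg ->; rewrite gtr0_sg.
have [A [Aop Au] Asub] := nbhs_open (filterI (near_cod iu) sg).
exists A => //.
have Cc : Ck k A (vector_product i).
  by apply: Ck_subset (vector_product_smooth i k) => v /Asub[].
have s2_gt0 v : A v -> 0 < dotr (vector_product i v) (vector_product i v).
  move=> /Asub[iv sv]; rewrite s2// exprn_even_gt0//= -sgr_eq0 sv.
  by rewrite sgr_eq0.
have Cs := CkV Aop _ (Ck_sqrt Aop s2_gt0 (Ck_dotr Aop Cc Cc)).
have {}Cs : Ck k A (fun v => (Num.sqrt (dotr (vector_product i v) (vector_product i v)))^-1).
  by apply: Cs => v /s2_gt0 ?; rewrite gt_eqF// sqrtr_gt0.
apply: (Ck_row Aop) => l.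
apply: (Ck_eq Aop _ (CkM Aop (CkM Aop (Ck_cst Aop k (Num.sg (s u))) Cs)
  (Ck_coord Aop 0 l Cc))) => v Av.
have [iv sv] := Asub v Av.
have sv0 : s v != 0 by rewrite -sgr_eq0 sv sgr_eq0.
have cE : vector_product i v 0 l = s v * nu i v 0 l.
  by rewrite vector_productE// mxE.
rewrite cE s2// sqrtr_sqr -sv [Num.sg _ * _]mulrC -mulrA (mulrA (Num.sg _)).
by rewrite -normrEsg mulKf// normr_eq0.
Qed.

End Hypersurface.

(** * Principal frames *)

Section Frames.
Context {R : realType} {n : nat} {M : topologicalType}.
Context {S : smooth_atlas R n M} {g : riemannian_metric S}.
Context {X N : M -> 'rV[R]_n.+1}.
Hypothesis X_isometric : isometric_immersion g X.
Hypothesis N_normal : unit_normal_field S X N.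

Local Notation x i := (X \o param i).
Local Notation nu i := (N \o param i).
Implicit Types (i : chart S) (u v w : 'rV[R]_n).

Lemma Ck_is_derive {W : normedModType R} (U : set 'rV[R]_n) (f : 'rV[R]_n -> W) u v :
  Ck 1 U f -> U u -> is_derive u v f ('D_v f u).
Proof. by move=> [df _] Uu; exact/derivableP/diff_derivable/df. Qed.

Lemma is_derive_position i u v : cod i u -> is_derive u v (x i) ('D_v (x i) u).
Proof. exact: Ck_is_derive (position_smooth X_isometric i 1). Qed.

Lemma is_derive_position2 i u v w : cod i u ->
  is_derive u v ('D_w (x i)) ('D_v ('D_w (x i)) u).
Proof. exact: Ck_is_derive ((position_smooth X_isometric i 2).2 w). Qed.

Lemma is_derive_normal i u v : cod i u -> is_derive u v (nu i) ('D_v (nu i) u).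
Proof. exact: Ck_is_derive (normal_smooth X_isometric N_normal i 1). Qed.

Lemma is_derive_normal2 i u v w : cod i u ->
  is_derive u v ('D_w (nu i)) ('D_v ('D_w (nu i)) u).
Proof. exact: Ck_is_derive ((normal_smooth X_isometric N_normal i 2).2 w). Qed.

Lemma normal_differentiable i u : cod i u -> differentiable (nu i) u.
Proof. by move=> iu; exact: (normal_smooth X_isometric N_normal i 1).1. Qed.

Lemma position_derive_sym i u v w : cod i u ->
  'D_w ('D_v (x i)) u = 'D_v ('D_w (x i)) u.
Proof.
move=> iu; apply: (@Ck_derive_sym _ _ (cod i)) => //; first exact: cod_open.
exact: (position_smooth X_isometric i 2).
Qed.

Lemma normal_derive_sym i u v w : cod i u ->
  'D_w ('D_v (nu i)) u = 'D_v ('D_w (nu i)) u.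
Proof.
move=> iu; apply: (@Ck_derive_sym _ _ (cod i)) => //; first exact: cod_open.
exact: (normal_smooth X_isometric N_normal i 2).
Qed.

Lemma is_derive_near_cst (f : 'rV[R]_n -> R) (c : R) i u v d : cod i u ->
  (forall y, cod i y -> f y = c) -> is_derive u v f d -> d = 0.
Proof.
move=> iu fc [_ <-]; rewrite -(derive_cst c u v); apply: near_eq_derive.
by apply: filterS (near_cod iu) => y /fc ->.
Qed.

Lemma normal_derive_orthogonal i u v : cod i u ->
  dotr ('D_v (nu i) u) (nu i u) = 0.
Proof.
move=> iu; have dn := is_derive_normal v iu.
have := is_derive_near_cst (c := 1) iu (fun y _ => normal_unit N_normal i y)
  (is_derive_dotr dn dn).
by rewrite [X in _ + X]dotrC -mulr2n => /eqP; rewrite mulrn_eq0 => /eqP.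
Qed.

Lemma second_form_position i u v w : cod i u ->
  dotr ('D_v (nu i) u) ('D_w (x i) u) = - dotr ('D_v ('D_w (x i)) u) (nu i u).
Proof.
move=> iu; have := is_derive_near_cst (c := 0) iu
  (fun y iy => tangent_normal N_normal w iy)
  (is_derive_dotr (is_derive_position2 v w iu) (is_derive_normal v iu)).
by rewrite [X in _ + X]dotrC addrC => /eqP; rewrite addr_eq0 => /eqP.
Qed.

(** Weingarten and the symmetry of second derivatives: both sides are the
    normal component of the second derivative of the position. *)
Lemma second_form_sym i u v w : cod i u ->
  dotr ('D_v (nu i) u) ('D_w (x i) u) = dotr ('D_w (nu i) u) ('D_v (x i) u).
Proof.
move=> iu; apply: etrans (second_form_position v w iu) _.
apply: etrans (esym (second_form_position w v iu)).
exact: (congr1 (fun y => - dotr y (nu i u)) (position_derive_sym w v iu)).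
Qed.

Lemma normal_derive_sum i u (I : finType) (c : I -> R) (e : I -> 'rV[R]_n) : cod i u ->
  'D_(\sum_j c j *: e j) (nu i) u = \sum_j c j *: 'D_(e j) (nu i) u.
Proof.
move=> iu; have dn := normal_differentiable iu.
by rewrite derive_sum_dir//; apply: eq_bigr => j _; rewrite derive_scale.
Qed.

Lemma frame_expansion i u (e : 'I_n -> 'rV[R]_n) : cod i u ->
  (forall j k, dotr ('D_(e j) (x i) u) ('D_(e k) (x i) u) = (j == k)%:R) ->
  forall y, y = \sum_j dotr y ('D_(e j) (x i) u) *: 'D_(e j) (x i) u +
    dotr y (nu i u) *: nu i u.
Proof.
move=> iu ee; apply: orthonormal_expansion => //.
  by move=> j; exact: (tangent_normal N_normal).
exact: (normal_unit N_normal).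
Qed.

(** Both forms are symmetric and the metric is definite, so the spectral theorem
    applies to the second form relative to the first. *)
Lemma exists_diagonal_frame i u : cod i u ->
  exists (e : 'I_n -> 'rV[R]_n) (d : 'I_n -> R),
  (forall j k, dotr ('D_(e j) (x i) u) ('D_(e k) (x i) u) = (j == k)%:R) /\
  (forall j, 'D_(e j) (nu i) u = - (d j *: 'D_(e j) (x i) u)).
Proof.
move=> iu.
pose B : 'M[R]_n := \matrix_(j, k)
  - dotr ('D_(delta_mx 0 j) (nu i) u) ('D_(delta_mx 0 k) (x i) u).
have BE v w : bform B v w = - dotr ('D_v (nu i) u) ('D_w (x i) u).
  rewrite {2}[v]row_sum_delta {2}[w]row_sum_delta normal_derive_sum//.
  rewrite (position_derive_sum X_isometric)// dotr_sumr -sumrN bformE.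
  apply: eq_bigr => k _; rewrite mxE mulr_suml dotr_suml -sumrN.
  apply: eq_bigr => j _; rewrite mxE dotrZl dotrZr; ring.
have Bs : B^T = B.
  apply/matrixP => j k; rewrite !mxE.
  exact: (congr1 -%R (second_form_sym _ _ iu)).
have [e [d [eG eB]]] :=
  simultaneous_diagonalization (gmx_sym g iu) Bs (fun v => @gmx_pos _ _ _ _ g i u v iu).
have ee j k : dotr ('D_(e j) (x i) u) ('D_(e k) (x i) u) = (j == k)%:R.
  by rewrite (metricE X_isometric).
exists e, d; split => // j.
rewrite [LHS](frame_expansion iu ee) normal_derive_orthogonal// scale0r addr0.
have c k : dotr ('D_(e j) (nu i) u) ('D_(e k) (x i) u) = - (d j * (j == k)%:R).
  by rewrite -eG -eB BE opprK.
rewrite (bigD1 j)//= big1 ?addr0 => [|k kj].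
  by rewrite c eqxx mulr1 scaleNr.
by rewrite c eq_sym (negPf kj) mulr0 oppr0 scale0r.
Qed.

Lemma frame_unitmx i u (e : 'I_n -> 'rV[R]_n) : cod i u ->
  (forall j k, dotr ('D_(e j) (x i) u) ('D_(e k) (x i) u) = (j == k)%:R) ->
  \matrix_j e j \in unitmx.
Proof.
move=> iu ee; rewrite -row_free_unit; apply/row_freeP.
exists (gmx g i u *m (\matrix_j e j)^T); apply/matrixP => j k.
rewrite [RHS]mxE -ee (metricE X_isometric)// /bform mulmxA !mxE.
apply: eq_bigr => l _; rewrite !mxE; congr (_ * _).
by apply: eq_bigr => m _; rewrite !mxE.
Qed.

(** Some matrix satisfies the equation that specifies the shape operator,
    namely the diagonal one in a principal basis. *)
Lemma shape_operatorP p v : let i := chart_at S p in let u := Defs.coord i p in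
  'D_(v *m shape_operator S X N p) (x i) u = - 'D_v (nu i) u.
Proof.
move=> i u; have iu : cod i u by apply/coord_cod/chart_atP.
rewrite /shape_operator; set P := (X in xget _ X).
suff : P (xget 0 P) by apply.
apply: xgetPex; have [e [d [ee ed]]] := exists_diagonal_frame iu.
pose E := \matrix_j e j.
have uE : E \in unitmx := frame_unitmx iu ee.
exists (invmx E *m (\matrix_j (d j *: e j))) => w /=.
rewrite -/i -/u -{2}(mulmxKV uE w) mulmxA.
rewrite !(mulmx_sum_row (w *m invmx E)).
rewrite (eq_bigr (fun j => (w *m invmx E) 0 j *: (d j *: e j))); last first.
  by move=> j _; rewrite rowK.
rewrite [in RHS](eq_bigr (fun j => (w *m invmx E) 0 j *: e j)); last first.
  by move=> j _; rewrite rowK.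
rewrite (position_derive_sum X_isometric)// normal_derive_sum// -sumrN.
apply: eq_bigr => j _; rewrite derive_scale ?ed ?scalerN ?opprK//.
exact: (position_differentiable X_isometric).
Qed.

(** An orthonormal basis of principal directions, ordered so that it matches
    the tuple [principal_curvatures]; everything pointwise is computed in it. *)
Lemma principal_frame p : let i := chart_at S p in let u := Defs.coord i p in
  exists e : 'I_n -> 'rV[R]_n,
  (forall j k, dotr ('D_(e j) (x i) u) ('D_(e k) (x i) u) = (j == k)%:R) /\
  (forall j, 'D_(e j) (nu i) u =
     - (tnth (principal_curvatures S X N p) j *: 'D_(e j) (x i) u)).
Proof.
move=> i u; have iu : cod i u by apply/coord_cod/chart_atP.
have [e [d [ee ed]]] := exists_diagonal_frame iu.
have uE := frame_unitmx iu ee.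
have EA j : row j (\matrix_j e j) *m shape_operator S X N p =
    d j *: row j (\matrix_j e j).
  rewrite rowK; apply/eqP; rewrite -subr_eq0; apply/eqP.
  apply: (immersion_injective X_isometric iu).
  have dx := position_differentiable X_isometric iu.
  rewrite derive_add// -scaleN1r derive_scale// scaleN1r derive_scale//.
  by rewrite shape_operatorP ed opprK subrr.
have cp := char_poly_eigenbasis uE EA.
have tE : \prod_(a <- [tuple d j | j < n]) ('X - a%:P) = \prod_j ('X - (d j)%:P).
  by rewrite big_tuple; apply: eq_bigr => j _; rewrite tnth_mktuple.
have tP : char_poly (shape_operator S X N p) =
    \prod_(a <- principal_curvatures S X N p) ('X - a%:P).
  rewrite /principal_curvatures; set P := (X in xget _ X).
  suff : P (xget [tuple of nseq n 0] P) by [].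
  by apply: xgetPex; exists [tuple d j | j < n]; exact: etrans cp (esym tE).
have /tuple_permP[s ts] : perm_eq (principal_curvatures S X N p) [tuple d j | j < n].
  by apply: prod_XsubC_eq; rewrite -tP cp -tE.
exists (fun j => e (s j)); split=> [j k|j]; first by rewrite ee (inj_eq perm_inj).
rewrite ed; congr (- (_ *: _)).
by rewrite (tnth_nth 0) ts -tnth_nth !tnth_mktuple.
Qed.

End Frames.

(** * The Gauss-Kronecker curvature in a chart *)

Lemma is_derive_lineP {R : realType} {V W : normedModType R} (f : V -> W) x v d :
  is_derive x v f d <-> is_derive (0 : R) (1 : R) (fun s => f (s *: v + x)) d.
Proof.
have E : (fun h : R => h^-1 *: (((fun s => f (s *: v + x)) \o shift 0) (h *: 1) -
      f (0 *: v + x))) =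
    (fun h => h^-1 *: ((f \o shift x) (h *: v) - f x)).
  by apply/funext => h /=; rewrite [h *: 1]mulr1 addr0 scale0r add0r.
split=> -[df <-]; last by split; [move: df; rewrite /derivable E|rewrite /derive E].
by split; rewrite /derivable /derive E.
Qed.

Lemma is_derive_comp_real {R : realType} {V : normedModType R} (f : V -> R)
    (rho : R -> R) x v d r :
  is_derive (f x) (1 : R) rho r -> is_derive x v f d ->
  is_derive x v (fun y => rho (f y)) (r * d).
Proof.
move=> dr /is_derive_lineP df; apply/is_derive_lineP.
apply: (is_derive1_comp (f := rho) (g := fun s => f (s *: v + x))) => //.
by rewrite scale0r add0r.
Qed.

(** Summing the second order conditions [k2 k + ...] with the weights [P k],
    which are nonnegative, is taking the trace against the Newton transformation.
    The derivatives [a] and [g] of the fundamental forms cancel by the formula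
    for the derivative of a determinant, and the
    terms [r] and [m] along the trace of the Hessian cancel by criticality. *)
Lemma weighted_trace_inequality {R : realType} n (c P a g r m q k2 : 'I_n -> R)
    (K kw b t r1 r2 : R) :
  (forall k, 0 <= P k) -> (forall k, P k * c k = K) ->
  kw + K * (\sum_k g k) = \sum_k a k * P k ->
  (forall k, k2 k = c k - (r k - a k + c k * g k + K * c k ^+ 2)) ->
  (forall k, k2 k + (r2 * q k ^+ 2 + r1 * (1 + m k)) <= 0) ->
  r1 * (\sum_k P k * m k) = \sum_k P k * r k + r1 * (n%:R * K * b) ->
  kw = - (r1 * t) ->
  K * (n%:R - (\sum_k c k) * K) + r2 * (\sum_k P k * q k ^+ 2) +
    r1 * (\sum_k P k + n%:R * K * b - t) <= 0.
Proof.
move=> P0 Pc hJ hk2 htest hm hkw.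
have : \sum_k P k * (k2 k + (r2 * q k ^+ 2 + r1 * (1 + m k))) <= 0.
  by apply: sumr_le0 => k _; rewrite mulr_ge0_le0.
rewrite (eq_bigr (fun k => K + a k * P k - P k * r k - K * g k - K * K * c k +
   (r2 * (P k * q k ^+ 2) + (r1 * P k + r1 * (P k * m k))))); last first.
  move=> k _; rewrite hk2 -(Pc k); ring.
rewrite !big_split /= !sumrN -!mulr_sumr -hJ sumr_const card_ord -mulr_natl hm hkw.
move=> h; apply: le_trans h; rewrite le_eqVlt; apply/orP; left; apply/eqP; ring.
Qed.

Section EvolutionInequality.
Context {R : realType} {n : nat} {M : topologicalType}.
Context {S : smooth_atlas R n M} {g : riemannian_metric S}.
Context {X N : M -> 'rV[R]_n.+1}.
Hypothesis X_isometric : isometric_immersion g X.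
Hypothesis N_normal : unit_normal_field S X N.

Local Notation x i := (X \o param i).
Local Notation nu i := (N \o param i).
Implicit Types (i : chart S) (u v w : 'rV[R]_n).

(** Chain rule for a change of chart; curvatures at nearby points are each
    defined in a chart of their own. *)
Lemma derive_change_chart (f : M -> 'rV[R]_n.+1) i (j : chart S) u v :
  cod i u -> dom j (param i u) ->
  differentiable (f \o param j) (Defs.coord j (param i u)) ->
  'D_v (f \o param i) u =
  'D_('D_v (Defs.coord j \o param i) u) (f \o param j) (Defs.coord j (param i u)).
Proof.
move=> iu ju df.
have dt : differentiable (Defs.coord j \o param i) u.
  by have [+ _] := transition_smooth (s := S) i j 1; apply.
apply: etrans (derive_chain v dt df); apply: near_eq_derive.
have jn : \forall y \near u, dom j (param i y).
  have := open_nbhs_nbhs (conj (dom_open (s := S) j) ju).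
  exact: (param_continuous iu).
by apply: filterS jn => y jy /=; rewrite coordK.
Qed.

(** The ratio of the determinants of the two fundamental forms does not depend
    on the chart; this makes the curvature differentiable near a point. *)
Lemma gauss_kronecker_det i u (e : 'I_n -> 'rV[R]_n) : cod i u ->
  gauss_kronecker S X N (param i u) *
    \det (\matrix_(j, k) dotr ('D_(e j) (x i) u) ('D_(e k) (x i) u)) =
  \det (\matrix_(j, k) - dotr ('D_(e j) (nu i) u) ('D_(e k) (x i) u)).
Proof.
move=> iu; set p := param i u.
have := principal_frame X_isometric N_normal p.
set j := chart_at S p; set u' := Defs.coord j p => -[e' [ee' ed']].
have jp : dom j p by exact: chart_atP.
have ju' : cod j u' by exact: coord_cod.
have [t [xt nt]] : exists t : 'rV[R]_n -> 'rV[R]_n,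
    (forall v, 'D_v (x i) u = 'D_(t v) (x j) u') /\
    (forall v, 'D_v (nu i) u = 'D_(t v) (nu j) u').
  exists (fun v => 'D_v (Defs.coord j \o param i) u); split=> v;
    apply: derive_change_chart => //.
    exact: (position_differentiable X_isometric).
  exact: (normal_differentiable X_isometric N_normal).
pose k l := tnth (principal_curvatures S X N p) l.
have [c cE] : exists c : 'rV[R]_n -> 'I_n -> R,
    forall v l, dotr ('D_v (x i) u) ('D_(e' l) (x j) u') = c v l by eexists.
have nu_l v l : dotr ('D_v (nu i) u) ('D_(e' l) (x j) u') = - (k l * c v l).
  apply: etrans (congr1 (dotr^~ _) (nt v)) _.
  apply: etrans (second_form_sym X_isometric N_normal _ _ ju') _.
  apply: etrans (congr1 (dotr^~ _) (ed' l)) _.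
  rewrite dotrNl dotrZl -(xt v).
  exact: (congr1 (fun y => - (k l * y)) (etrans (dotrC _ _) (cE v l))).
have xN v : dotr ('D_v (x i) u) (nu j u') = 0.
  apply: etrans (congr1 (dotr^~ _) (xt v)) _.
  exact: (tangent_normal N_normal).
have dotx y v : dotr y ('D_v (x i) u) = \sum_l dotr y ('D_(e' l) (x j) u') * c v l.
  have E := frame_expansion N_normal ju' ee' ('D_v (x i) u).
  apply: etrans (congr1 (dotr y) E) _.
  rewrite dotrDr dotrZr xN mul0r addr0 dotr_sumr; apply: eq_bigr => l _.
  by rewrite dotrZr cE mulrC.
have xx v w : dotr ('D_v (x i) u) ('D_w (x i) u) = \sum_l c v l * c w l.
  by apply: etrans (dotx _ _) _; apply: eq_bigr => l _; rewrite cE.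
have nx v w : - dotr ('D_v (nu i) u) ('D_w (x i) u) = \sum_l c v l * k l * c w l.
  apply: etrans (congr1 -%R (dotx _ _)) _; rewrite -sumrN; apply: eq_bigr => l _.
  by rewrite nu_l mulNr opprK (mulrC (k l)).
pose C : 'M[R]_n := \matrix_(a, l) c (e a) l.
have -> : \matrix_(a, b) dotr ('D_(e a) (x i) u) ('D_(e b) (x i) u) = C *m C^T.
  apply/matrixP => a b; rewrite [LHS]mxE [RHS]mxE; apply: etrans (xx _ _) _.
  by apply: eq_bigr => l _; rewrite !mxE.
have -> : \matrix_(a, b) - dotr ('D_(e a) (nu i) u) ('D_(e b) (x i) u) =
    C *m diag_mx (\row_l k l) *m C^T.
  apply/matrixP => a b; rewrite [LHS]mxE [RHS]mxE; apply: etrans (nx _ _) _.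
  by apply: eq_bigr => l _; rewrite mul_mx_diag !mxE.
rewrite !det_mulmx det_tr det_diag (eq_bigr k) => [|l _]; last by rewrite mxE.
rewrite -[gauss_kronecker _ _ _ _]/(\prod_l k l); ring.
Qed.

End EvolutionInequality.

(** * Derivatives of the curvature and of the test functions *)

Section MaximumPrinciple.
Context {R : realType} {n : nat} {M : topologicalType}.
Context {S : smooth_atlas R n M} {g : riemannian_metric S}.
Context {X N : M -> 'rV[R]_n.+1}.
Hypothesis X_isometric : isometric_immersion g X.
Hypothesis N_normal : unit_normal_field S X N.
Hypothesis X_weakly_convex : weakly_convex g X N.
Hypothesis X_shrinker : gauss_self_shrinker S X N.

Local Notation x i := (X \o param i).
Local Notation nu i := (N \o param i).
Local Notation curv p := (tnth (principal_curvatures S X N p)).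
Implicit Types (i : chart S) (u v w : 'rV[R]_n).

Lemma curvature_ge0 p k : 0 <= curv p k.
Proof.
have [e [ee ed]] := principal_frame X_isometric N_normal p.
have iu : cod (chart_at S p) (Defs.coord (chart_at S p) p).
  by apply/coord_cod/chart_atP.
have wc : 0 <= bform (gmx g (chart_at S p) (Defs.coord (chart_at S p) p))
  (e k *m shape_operator S X N p) (e k) := X_weakly_convex p (e k).
move: wc; rewrite -(metricE X_isometric _ _ iu).
rewrite (shape_operatorP X_isometric N_normal p (e k)) ed opprK dotrZl ee eqxx.
by rewrite mulr1.
Qed.

Lemma is_derive_half_square (f : 'rV[R]_n -> 'rV[R]_n.+1) y u v df :
  is_derive u v f df ->
  is_derive u v (fun t => dotr (f t - y) (f t - y) / 2) (dotr (f u - y) df).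
Proof.
move=> dfu.
have dfy : is_derive u v (fun t => f t - y) df.
  have := is_deriveB dfu (is_derive_cst y u v).
  by move/is_derive_eq; apply; rewrite subr0.
have := is_derive_mulr (is_derive_dotr dfy dfy) (is_derive_cst (2^-1 : R) u v).
move/is_derive_eq; apply; rewrite mulr0 addr0 [dotr df _]dotrC.
by move: (dotr (f u - y) df) => a /=; field.
Qed.

Section SecondOrderTest.
Variables (i : chart S) (y : 'rV[R]_n.+1) (rho rho1 rho2 : R -> R).
Hypothesis drho : forall s, is_derive s (1 : R) rho (rho1 s).
Hypothesis drho1 : forall s, is_derive s (1 : R) rho1 (rho2 s).

Let h u := dotr (x i u - y) (x i u - y) / 2.
Let F u := - dotr (x i u) (nu i u) + rho (h u).

Lemma is_derive_support u v : cod i u ->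
  is_derive u v (fun t => - dotr (x i t) (nu i t)) (- dotr (x i u) ('D_v (nu i) u)).
Proof.
move=> iu.
have d := is_derive_dotr (is_derive_position X_isometric v iu)
  (is_derive_normal X_isometric N_normal v iu).
have := is_deriveN d; move/is_derive_eq; apply.
by rewrite (tangent_normal N_normal v iu) add0r.
Qed.

Lemma is_derive_test u v : cod i u ->
  is_derive u v F (- dotr (x i u) ('D_v (nu i) u) +
    rho1 (h u) * dotr (x i u - y) ('D_v (x i) u)).
Proof.
move=> iu; apply: is_deriveD; first exact: is_derive_support.
exact: (is_derive_comp_real (f := h) (drho (h u))
  (is_derive_half_square y (is_derive_position X_isometric v iu))).
Qed.

Lemma differentiable_test u : cod i u -> differentiable F u.
Proof.
move=> iu; have op := @cod_open _ _ _ S i.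
have [dk _] := Ck_dotr op (position_smooth X_isometric i 1)
  (normal_smooth X_isometric N_normal i 1).
apply: (@differentiableD _ _ _ (fun t => - dotr (x i t) (nu i t)) (rho \o h)).
  by apply: (@differentiableN _ _ _ (fun t => dotr (x i t) (nu i t))); exact: dk.
apply: (@differentiable_comp _ _ _ _ h rho); last first.
  by apply/derivable1_diffP; have [] := drho (h u).
have C1 : Ck 1 (cod i) (fun t => x i t - y).
  exact: (CkD op (position_smooth X_isometric i 1) (Ck_cst op 1 (- y : 'rV[R]_n.+1))).
have [dh _] := CkM op (Ck_dotr op C1 C1) (Ck_cst op 1 (2^-1 : R)).
exact: dh.
Qed.

Lemma critical_point u v : cod i u -> (\forall t \near u, F t <= F u) ->
  - dotr (x i u) ('D_v (nu i) u) + rho1 (h u) * dotr (x i u - y) ('D_v (x i) u) = 0.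
Proof.
move=> iu Fmax; have [_ <-] := is_derive_test v iu.
exact: derive_local_max (differentiable_test iu) Fmax.
Qed.

(** The conditions at a maximum of [F], in chart coordinates. No Christoffel
    symbol appears, since first derivatives of [F] vanish there. *)
Lemma second_order_test u v : cod i u -> (\forall t \near u, F t <= F u) ->
  - (dotr ('D_v (x i) u) ('D_v (nu i) u) + dotr (x i u) ('D_v ('D_v (nu i)) u)) +
  (rho2 (h u) * dotr (x i u - y) ('D_v (x i) u) ^+ 2 +
   rho1 (h u) * (dotr ('D_v (x i) u) ('D_v (x i) u) +
                 dotr (x i u - y) ('D_v ('D_v (x i)) u))) <= 0.
Proof.
move=> iu Fmax.
pose F' t := - dotr (x i t) ('D_v (nu i) t) +
  rho1 (h t) * dotr (x i t - y) ('D_v (x i) t).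
have FF' : \forall t \near u, F' t = 'D_v F t.
  apply: filterS (near_cod iu) => t it.
  by apply/esym; have [_ ->] := is_derive_test v it.
have dx := is_derive_position X_isometric v iu.
have dn := is_derive_normal2 X_isometric N_normal v v iu.
have ddx := is_derive_position2 X_isometric v v iu.
have dxy : is_derive u v (fun t => x i t - y) ('D_v (x i) u).
  have := is_deriveB dx (is_derive_cst y u v).
  by move/is_derive_eq; apply; rewrite subr0.
have dr : is_derive u v (fun t => rho1 (h t)) (rho2 (h u) * dotr (x i u - y) ('D_v (x i) u)).
  exact: (is_derive_comp_real (f := h) (drho1 (h u)) (is_derive_half_square y dx)).
have dF' := is_deriveD (is_deriveN (is_derive_dotr dx dn))
  (is_derive_mulr dr (is_derive_dotr dxy ddx)).
have [dF2 D2] := near_eq_is_derive FF' dF'.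
have dF : \forall t \near u, differentiable F t.
  by apply: filterS (near_cod iu) => t; exact: differentiable_test.
have D2le := derive2_local_max dF dF2 Fmax; rewrite D2 in D2le.
by rewrite expr2 mulrA.
Qed.

End SecondOrderTest.

(** The logarithmic derivative of the Gauss-Kronecker curvature, read in a
    principal frame and multiplied out so that it holds where it vanishes. *)
Lemma gauss_kronecker_derive i u w (e : 'I_n -> 'rV[R]_n) (c : 'I_n -> R) : cod i u ->
  (forall j k, dotr ('D_(e j) (x i) u) ('D_(e k) (x i) u) = (j == k)%:R) ->
  (forall j, 'D_(e j) (nu i) u = - (c j *: 'D_(e j) (x i) u)) ->
  - dotr (x i u) ('D_w (nu i) u) + - dotr (x i u) (nu i u) *
      \sum_k 2 * dotr ('D_w ('D_(e k) (x i)) u) ('D_(e k) (x i) u) =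
  \sum_k - (dotr ('D_w ('D_(e k) (nu i)) u) ('D_(e k) (x i) u) +
             dotr ('D_(e k) (nu i) u) ('D_w ('D_(e k) (x i)) u)) *
    \prod_(j | j != k) c j.
Proof.
move=> iu ee ed.
pose G t : 'M[R]_n := \matrix_(j, k) dotr ('D_(e j) (x i) t) ('D_(e k) (x i) t).
pose B t : 'M[R]_n := \matrix_(j, k) - dotr ('D_(e j) (nu i) t) ('D_(e k) (x i) t).
pose dG : 'M[R]_n := \matrix_(j, k)
  (dotr ('D_w ('D_(e j) (x i)) u) ('D_(e k) (x i) u) +
   dotr ('D_(e j) (x i) u) ('D_w ('D_(e k) (x i)) u)).
pose dB : 'M[R]_n := \matrix_(j, k)
  - (dotr ('D_w ('D_(e j) (nu i)) u) ('D_(e k) (x i) u) +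
     dotr ('D_(e j) (nu i) u) ('D_w ('D_(e k) (x i)) u)).
have ddx k := is_derive_position2 X_isometric w (e k) iu.
have ddn k := is_derive_normal2 X_isometric N_normal w (e k) iu.
have dGu j k : is_derive u w (fun t => G t j k) (dG j k).
  have GE : (fun t => G t j k) = (fun t => dotr ('D_(e j) (x i) t) ('D_(e k) (x i) t)).
    by apply/funext => t; exact: mxE.
  by rewrite GE [dG j k]mxE; exact: (is_derive_dotr (ddx j) (ddx k)).
have dBu j k : is_derive u w (fun t => B t j k) (dB j k).
  have BE : (fun t => B t j k) = (fun t => - dotr ('D_(e j) (nu i) t) ('D_(e k) (x i) t)).
    by apply/funext => t; exact: mxE.
  by rewrite BE [dB j k]mxE; exact: (is_deriveN (is_derive_dotr (ddn j) (ddx k))).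
have G1 j k : G u j k = 1 * (j == k)%:R by rewrite mxE mul1r ee.
have B1 j k : B u j k = c j * (j == k)%:R.
  rewrite mxE; apply: etrans (congr1 (fun z => - dotr z _) (ed j)) _.
  by rewrite dotrNl opprK dotrZl ee.
have dL := is_derive_mulr (is_derive_support w iu) (is_derive_det_diag dGu G1).
have dR := is_derive_det_diag dBu B1.
have LR : \forall t \near u, - dotr (x i t) (nu i t) * \det (G t) = \det (B t).
  apply: filterS (near_cod iu) => t it.
  rewrite -(gauss_kronecker_det X_isometric N_normal e it); congr (_ * _).
  exact: (esym (X_shrinker (param i t))).
have [_ E] := near_eq_is_derive LR dL.
have [_ E'] := dR; rewrite E' in E.
have detG1 : \det (G u) = 1.
  rewrite (_ : G u = 1%:M) ?det1//.
  by apply/matrixP => j k; rewrite G1 mul1r [RHS]mxE.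
rewrite detG1 mulr1 in E.
apply: etrans (etrans (esym E) _).
  congr (_ + _ * _); apply: eq_bigr => k _.
  by rewrite big1 ?mulr1// [dG k k]mxE [X in _ = _ + X]dotrC mulr_natl.
by apply: eq_bigr => k _; rewrite [dB k k]mxE.
Qed.


End MaximumPrinciple.

(** * The evolution inequality at a local maximum *)

(** The pointwise algebra of the evolution inequality: [E] is a principal
    orthonormal frame, [xw] the tangential part of the position, [s] the trace of
    the second derivatives of the position and [xz] its tangential part; [nw]
    and [nz] are the derivatives of the normal in these directions. *)
Lemma frame_inequality {R : realType} n (Xp Np y nw nz xw xz s : 'rV[R]_n.+1)
    (E nE xEE nEE A B : 'I_n -> 'rV[R]_n.+1) (c P : 'I_n -> R) (K r1 r2 : R) :
  (forall k, 0 <= P k) -> (forall k, P k * c k = K) -> K = - dotr Xp Np ->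
  (forall k, dotr (E k) (E k) = 1) -> (forall k, nE k = - (c k *: E k)) ->
  xw = Xp - dotr Xp Np *: Np -> s = \sum_k P k *: xEE k ->
  xz = s - dotr s Np *: Np ->
  dotr nz Np = 0 -> dotr nw Np = 0 -> dotr nz xw = dotr nw xz ->
  (forall k, dotr (xEE k) Np = - dotr (nE k) (E k)) ->
  (forall k, dotr (nEE k) Np = - dotr (nE k) (nE k)) ->
  (forall k, dotr (nEE k) xw + dotr (nE k) (A k) =
             dotr (B k) (E k) + dotr nw (xEE k)) ->
  - dotr Xp nw + - dotr Xp Np * (\sum_k 2 * dotr (A k) (E k)) =
    \sum_k - (dotr (B k) (E k) + dotr (nE k) (A k)) * P k ->
  - dotr Xp nw + r1 * dotr (Xp - y) xw = 0 ->
  - dotr Xp nz + r1 * dotr (Xp - y) xz = 0 ->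
  (forall k, - (dotr (E k) (nE k) + dotr Xp (nEE k)) +
    (r2 * dotr (Xp - y) (E k) ^+ 2 +
     r1 * (dotr (E k) (E k) + dotr (Xp - y) (xEE k))) <= 0) ->
  K * (n%:R - (\sum_k c k) * K) +
    r2 * (\sum_k P k * dotr (Xp - y) (E k) ^+ 2) +
    r1 * (\sum_k P k + n%:R * K * dotr (Xp - y) Np -
      (dotr (Xp - y) Xp + K * dotr (Xp - y) Np)) <= 0.
Proof.
move=> P0 Pc KX EE nEE' xwE sE xzE nzN nwN sym xEEN nEEN sd hJ cw cz test.
have nEE2 k : dotr (nE k) (nE k) = c k ^+ 2.
  by rewrite nEE' dotrNl dotrNr opprK dotrZl dotrZr EE mulr1 expr2.
have nEEk k : dotr (nE k) (E k) = - c k by rewrite nEE' dotrNl dotrZl EE mulr1.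
have nEA k : dotr (nE k) (A k) = - (c k * dotr (A k) (E k)).
  by rewrite nEE' dotrNl dotrZl (dotrC (E k)).
have sN : dotr s Np = n%:R * K.
  rewrite sE dotr_suml (eq_bigr (fun=> K)) ?sumr_const ?card_ord ?mulr_natl//.
  by move=> k _; rewrite dotrZl xEEN nEEk opprK Pc.
have tE : dotr (Xp - y) xw = dotr (Xp - y) Xp + K * dotr (Xp - y) Np.
  by rewrite xwE dotrBr dotrZr KX mulNr.
rewrite -tE.
apply: (@weighted_trace_inequality _ _ c P
  (fun k => - (dotr (B k) (E k) + dotr (nE k) (A k)))
  (fun k => 2 * dotr (A k) (E k)) (fun k => dotr nw (xEE k))
  (fun k => dotr (Xp - y) (xEE k)) (fun k => dotr (Xp - y) (E k))
  (fun k => - (dotr (E k) (nE k) + dotr Xp (nEE k)))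
  K (- dotr Xp nw) (dotr (Xp - y) Np) (dotr (Xp - y) xw) r1 r2) => //.
- by rewrite [X in _ + X * _]KX.
- move=> k; rewrite (dotrC (E k)) nEEk.
  have XE : dotr Xp (nEE k) = dotr (nEE k) xw + K * c k ^+ 2.
    by rewrite xwE dotrBr dotrZr nEEN nEE2 (dotrC _ Xp) KX; ring.
  have := sd k; rewrite XE nEA => sdk.
  have -> : dotr (nEE k) xw = dotr (B k) (E k) + dotr nw (xEE k) +
    c k * dotr (A k) (E k) by rewrite -sdk; ring.
  ring.
- by move=> k; have := test k; rewrite EE.
- have -> : \sum_k P k * dotr (Xp - y) (xEE k) = dotr (Xp - y) s.
    by rewrite sE dotr_sumr; apply: eq_bigr => k _; rewrite dotrZr.
  have -> : \sum_k P k * dotr nw (xEE k) = dotr nw s.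
    by rewrite sE dotr_sumr; apply: eq_bigr => k _; rewrite dotrZr.
  have nws : dotr nw s = dotr nw xz.
    by rewrite xzE dotrBr dotrZr nwN mulr0 subr0.
  have nzX : dotr Xp nz = dotr nz xw.
    by rewrite xwE dotrBr dotrZr nzN mulr0 subr0 dotrC.
  have Xs : dotr (Xp - y) s = dotr (Xp - y) xz + n%:R * K * dotr (Xp - y) Np.
    by rewrite xzE dotrBr dotrZr sN; ring.
  rewrite nws -sym -nzX Xs mulrDr; congr (_ + _).
  by move: cz; rewrite addrC => /eqP; rewrite subr_eq0 => /eqP.
- by move: cw => /eqP; rewrite addr_eq0 => /eqP.
Qed.

Section LocalMaximum.
Context {R : realType} {n : nat} {M : topologicalType}.
Context {S : smooth_atlas R n M} {g : riemannian_metric S}.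
Context {X N : M -> 'rV[R]_n.+1}.
Hypothesis X_isometric : isometric_immersion g X.
Hypothesis N_normal : unit_normal_field S X N.
Hypothesis X_weakly_convex : weakly_convex g X N.
Hypothesis X_shrinker : gauss_self_shrinker S X N.

Local Notation x i := (X \o param i).
Local Notation nu i := (N \o param i).
Local Notation curv p := (tnth (principal_curvatures S X N p)).
Local Notation K := (gauss_kronecker S X N).
Local Notation H := (mean_curvature S X N).
Implicit Types (i : chart S) (u v w : 'rV[R]_n).

(** The tangential part of a vector is the derivative of the position in
    some constant direction of the chart. *)
Lemma tangent_lift i u (e : 'I_n -> 'rV[R]_n) (xi : 'rV[R]_n.+1) : cod i u ->
  (forall j k, dotr ('D_(e j) (x i) u) ('D_(e k) (x i) u) = (j == k)%:R) ->
  exists w, 'D_w (x i) u = xi - dotr xi (nu i u) *: nu i u.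
Proof.
move=> iu ee; exists (\sum_j dotr xi ('D_(e j) (x i) u) *: e j).
rewrite (position_derive_sum X_isometric _ _ iu).
by rewrite {2}(frame_expansion N_normal iu ee xi) addrK.
Qed.

(** The Codazzi equation, in coordinates: the derivative of the symmetry of
    the second fundamental form. *)
Lemma second_form_derive i u v w : cod i u ->
  dotr ('D_v ('D_v (nu i)) u) ('D_w (x i) u) +
    dotr ('D_v (nu i) u) ('D_w ('D_v (x i)) u) =
  dotr ('D_w ('D_v (nu i)) u) ('D_v (x i) u) +
    dotr ('D_w (nu i) u) ('D_v ('D_v (x i)) u).
Proof.
move=> iu.
have dxv a b := is_derive_position2 X_isometric (u := u) a b iu.
have dnv a b := is_derive_normal2 X_isometric N_normal (u := u) a b iu.
have dl := is_derive_dotr (dnv v v) (dxv v w).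
have dr := is_derive_dotr (dnv v w) (dxv v v).
have lr : \forall t \near u, dotr ('D_v (nu i) t) ('D_w (x i) t) =
    dotr ('D_w (nu i) t) ('D_v (x i) t).
  apply: filterS (near_cod iu) => t it.
  exact: (second_form_sym X_isometric N_normal v w it).
have [_ E] := near_eq_is_derive lr dl.
have [_ E'] := dr; rewrite E' in E.
have sx := position_derive_sym X_isometric w v iu.
have sn := normal_derive_sym X_isometric N_normal w v iu.
apply: etrans (congr1 (fun z => _ + dotr _ z) (esym sx)) _.
apply: etrans (esym E) _.
exact: (congr1 (fun z => dotr z _ + _) sn).
Qed.

Lemma normal_second_derive i u v : cod i u ->
  dotr ('D_v ('D_v (nu i)) u) (nu i u) = - dotr ('D_v (nu i) u) ('D_v (nu i) u).
Proof.
move=> iu; have dn := is_derive_normal X_isometric N_normal v iu.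
have ddn := is_derive_normal2 X_isometric N_normal v v iu.
have := is_derive_near_cst (c := 0) iu
  (fun t it => normal_derive_orthogonal X_isometric N_normal v it)
  (is_derive_dotr ddn dn).
by move=> /eqP; rewrite addr_eq0 => /eqP.
Qed.

(** At an interior maximum of a perturbation of the Gauss-Kronecker curvature
    by a function of the distance to [y], the operator [tr (P Hess)], with [P]
    the Newton transformation of order [n - 1], is nonpositive. *)
Lemma local_max_inequality p y (rho rho1 rho2 : R -> R) :
  (forall s, is_derive s (1 : R) rho (rho1 s)) ->
  (forall s, is_derive s (1 : R) rho1 (rho2 s)) ->
  (\forall q \near p, K q + rho (dotr (X q - y) (X q - y) / 2) <=
                      K p + rho (dotr (X p - y) (X p - y) / 2)) ->
  exists E : 'I_n -> 'rV[R]_n.+1,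
    (forall z, dotr z z = \sum_k dotr z (E k) ^+ 2 + dotr z (N p) ^+ 2) /\
    K p * (n%:R - H p * K p) +
    rho2 (dotr (X p - y) (X p - y) / 2) *
      (\sum_k \prod_(j | j != k) curv p j * dotr (X p - y) (E k) ^+ 2) +
    rho1 (dotr (X p - y) (X p - y) / 2) *
      (\sum_k \prod_(j | j != k) curv p j + n%:R * K p * dotr (X p - y) (N p) -
       (dotr (X p - y) (X p) + K p * dotr (X p - y) (N p))) <= 0.
Proof.
move=> drho drho1 pmax.
have [e [ee ed]] := principal_frame X_isometric N_normal p.
move: ee ed; set i := chart_at S p; set u := Defs.coord i p => ee ed.
have ip : dom i p by exact: chart_atP.
have iu : cod i u by exact: coord_cod.
have pu : param i u = p by exact: coordK.
have Xu : x i u = X p by rewrite /= pu.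
have Nu : nu i u = N p by rewrite /= pu.
clearbody u i.
pose F t := - dotr (x i t) (nu i t) + rho (dotr (x i t - y) (x i t - y) / 2).
have Fmax : \forall t \near u, F t <= F u.
  have pn : param i @ u --> p by rewrite -pu; exact: param_continuous.
  have tmax : \forall t \near u, K (param i t) +
      rho (dotr (x i t - y) (x i t - y) / 2) <=
      K p + rho (dotr (X p - y) (X p - y) / 2) := pn _ pmax.
  by apply: filterS tmax => t; rewrite /F Xu Nu !X_shrinker.
pose P k := \prod_(j | j != k) curv p j.
have [w xw] := tangent_lift (X p) iu ee.
pose s := \sum_k P k *: 'D_(e k) ('D_(e k) (x i)) u.
have [z xz] := tangent_lift s iu ee.
have FE := frame_expansion N_normal iu ee.
rewrite Nu in xw xz FE.
exists (fun k => 'D_(e k) (x i) u); split.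
  move=> a; have Ea := FE a; apply: etrans (congr1 (dotr a) Ea) _.
  rewrite dotrDr dotr_sumr dotrZr -expr2; congr (_ + _).
  by apply: eq_bigr => k _; rewrite dotrZr -expr2.
have crit v := critical_point X_isometric N_normal drho v iu Fmax.
have test v := second_order_test X_isometric N_normal drho drho1 v iu Fmax.
rewrite Xu in crit test.
apply: (@frame_inequality _ _ (X p) (N p) y ('D_w (nu i) u) ('D_z (nu i) u)
  ('D_w (x i) u) ('D_z (x i) u) s (fun k => 'D_(e k) (x i) u)
  (fun k => 'D_(e k) (nu i) u) (fun k => 'D_(e k) ('D_(e k) (x i)) u)
  (fun k => 'D_(e k) ('D_(e k) (nu i)) u) (fun k => 'D_w ('D_(e k) (x i)) u)
  (fun k => 'D_w ('D_(e k) (nu i)) u) (fun k => curv p k) P).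
- move=> k; apply: prodr_ge0 => j _.
  exact: (curvature_ge0 X_isometric N_normal X_weakly_convex).
- by move=> k; rewrite mulrC /gauss_kronecker [RHS](bigD1 k).
- exact: X_shrinker.
- by move=> k; apply: etrans (ee k k) _; rewrite eqxx.
- exact: ed.
- exact: xw.
- by [].
- exact: xz.
- by rewrite -Nu; exact: (normal_derive_orthogonal X_isometric N_normal).
- by rewrite -Nu; exact: (normal_derive_orthogonal X_isometric N_normal).
- exact: (second_form_sym X_isometric N_normal z w iu).
- move=> k; rewrite -Nu.
  by rewrite (second_form_position X_isometric N_normal (e k) (e k) iu) opprK.
- move=> k; rewrite -Nu; exact: (normal_second_derive (e k) iu).
- move=> k; exact: (second_form_derive (e k) w iu).
- have := gauss_kronecker_derive X_isometric N_normal X_shrinker w iu ee ed.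
  by rewrite Xu Nu.
- exact: (crit w).
- exact: (crit z).
- by move=> k; exact: (test (e k)).
Qed.

End LocalMaximum.

(** * Maxima of functions on a properly immersed hypersurface *)

Lemma compact_preimage {T U : topologicalType} (f : T -> U) (B : set T) (D : set U) :
  compact B -> closed D -> (forall t, B t -> {for t, continuous f}) ->
  compact (B `&` f @^-1` D).
Proof.
move=> cB cD cf F FF FBD.
have [t [Bt clt]] := cB F FF (filterS (@subIsetl _ _ _) FBD).
exists t; split=> //; split=> //; apply: cD => O fO.
have [z [[_ Dz] Oz]] := clt _ _ FBD (cf t Bt O fO).
by exists (f z).
Qed.

Lemma euclidean_ball_compact {R : realType} m (b : R) :
  compact [set y : 'rV[R]_m | dotr y y <= b].
Proof.
apply: bounded_closed_compact.
  exists (b + 1); split; first exact: num_real.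
  move=> z bz y /= yb; apply: le_trans (ltW bz).
  have b0 : 0 <= b by apply: le_trans yb; exact: dotr_ge0.
  rewrite /Num.Def.normr/= mx_normrE; apply: bigmax_le => [|[i j] _ /=].
    by rewrite addr_ge0.
  rewrite ord1; have : y 0 j ^+ 2 <= b.
    apply: le_trans yb; rewrite /dotr (bigD1 j)//= expr2 lerDl.
    by apply: sumr_ge0 => k _; rewrite -expr2 sqr_ge0.
  rewrite -real_normK ?num_real// => h; nra.
apply: (@preimage_closed _ _ (fun y : 'rV[R]_m => dotr y y) [set z | z <= b]).
  by move=> y _; apply: (@cvg_dotr _ _ (nbhs y) _ _ id id); exact: cvg_id.
exact: closed_le.
Qed.

Section GlobalMaximum.
Context {R : realType} {n : nat} {M : topologicalType}.
Context {S : smooth_atlas R n M} {g : riemannian_metric S}.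
Context {X N : M -> 'rV[R]_n.+1}.
Hypothesis X_isometric : isometric_immersion g X.
Hypothesis N_normal : unit_normal_field S X N.
Hypothesis X_proper : proper_map X.
Hypothesis X_weakly_convex : weakly_convex g X N.
Hypothesis X_shrinker : gauss_self_shrinker S X N.

Local Notation curv p := (tnth (principal_curvatures S X N p)).
Local Notation K := (gauss_kronecker S X N).
Local Notation H := (mean_curvature S X N).

(** A proper immersion turns bounds on the position into compactness. *)
Lemma proper_max (f : M -> R) (q0 : M) (b : R) : continuous f ->
  (forall q, f q0 < f q -> dotr (X q) (X q) <= b) ->
  exists p, forall q, f q <= f p.
Proof.
move=> cf fb; pose b' := Num.max b (dotr (X q0) (X q0)).
have cB := X_proper.2 _ (@euclidean_ball_compact R n.+1 b').
have [||p _ pmax] := compact_EVT_max (f := f) _ cB.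
- by exists q0; rewrite /= /b' le_max lexx orbT.
- exact: continuous_subspaceT.
exists p => q; have [q_in|q_out] := leP (dotr (X q) (X q)) b'.
  exact/pmax/mem_set.
apply: (@le_trans _ _ (f q0)); last first.
  by apply/pmax/mem_set; rewrite /= /b' le_max lexx orbT.
rewrite leNgt; apply/negP => /fb; apply/negP; rewrite -ltNge.
by apply: le_lt_trans q_out; rewrite /b' le_max lexx.
Qed.

Lemma continuous_dotr (f h : M -> 'rV[R]_n.+1) : continuous f -> continuous h ->
  continuous (fun p => dotr (f p) (h p)).
Proof.
by move=> cf ch p; apply: (@cvg_dotr _ _ (nbhs p) _ _ f h); [exact: cf|exact: ch].
Qed.

Lemma continuous_position : continuous X. Proof. exact: X_proper.1. Qed.

Lemma continuous_normal : continuous N. Proof. by case: N_normal. Qed.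

Lemma gauss_kronecker_continuous : continuous K.
Proof.
rewrite (_ : K = fun p => - dotr (X p) (N p)); last exact/funext/X_shrinker.
move=> p; apply: cvgN.
exact: (continuous_dotr continuous_position continuous_normal).
Qed.

Lemma gauss_kronecker_ge0 p : 0 <= K p.
Proof.
apply: prodr_ge0 => j _.
exact: (curvature_ge0 X_isometric N_normal X_weakly_convex).
Qed.

Lemma normal_dotr1 p : dotr (N p) (N p) = 1.
Proof. by case: N_normal. Qed.

(** A subset with [n - 1] elements omits exactly one index, so this symmetric
    function is the trace of the Newton transformation. *)
Lemma sigma_pred p : (0 < n)%N ->
  sigma S X N n.-1 p = \sum_k \prod_(j | j != k) curv p j.
Proof.
move=> n0; rewrite /sigma.
pose F (k : 'I_n) : {set 'I_n} := finset.setC (finset.set1 k).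
have inj : injective F by move=> a b /finset.setC_inj/finset.set1_inj.
rewrite (eq_bigl (fun I => I \in imset F (mem [pred k : 'I_n | true]))); last first.
  move=> I; apply/idP/imsetP => [cI|[k _ ->]]; last by rewrite cardsC1 card_ord.
  have : #|finset.setC I| == 1%N.
    by rewrite cardsCs finset.setCK (eqP cI) card_ord -subn1 subKn.
  by case/cards1P => k kI; exists k => //; rewrite /F -kI finset.setCK.
rewrite big_imset; last by move=> a b _ _; exact: inj.
by apply: eq_bigr => k _; apply: eq_bigl => j; rewrite !inE.
Qed.

(** The drift term makes the operator of the evolution inequality negative on
    the squared distance to the origin far away, so the maximum of the curvature
    cannot escape to infinity. *)
Lemma gauss_kronecker_attains_max (C : R) : (0 < n)%N -> [set: M] !=set0 ->
  (forall p, sigma S X N n.-1 p <= C) -> (forall p, H p * K p <= n%:R) ->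
  exists p, forall q, K q <= K p.
Proof.
move=> n0 [q0 _] sC HK.
have ex_eps (e : R) : 0 < e -> exists2 p, dotr (X p) (X p) <= C &
    forall q, K q - e * (dotr (X q) (X q) / 2) <= K p.
  move=> e0.
  pose f q := K q - e * (dotr (X q) (X q) / 2).
  have cf : continuous f.
    move=> q; apply: (@cvgB _ _ _ (nbhs q) _ K (fun q => e * (dotr (X q) (X q) / 2))).
      exact: gauss_kronecker_continuous.
    apply: cvgMr; apply: cvgMl.
    exact: (continuous_dotr continuous_position continuous_position).
  have [|p pmax] := @proper_max f q0 (4 / e * (1 / e - f q0)) cf.
    move=> q fq.
    have h : 0 <= dotr ((e / 2) *: X q + N q) ((e / 2) *: X q + N q) := dotr_ge0 _.
    move: h fq; rewrite /f !(dotrDl, dotrDr, dotrZl, dotrZr) normal_dotr1.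
    rewrite (dotrC (N q)) [K q]X_shrinker -/(f q0).
    set a := dotr (X q) (X q); set b := dotr (X q) (N q).
    move=> h fq.
    have -> : a = 4 / e * (e * a / 4) by field; rewrite gt_eqF.
    rewrite ler_pM2l; last by rewrite divr_gt0.
    have : 0 <= e * a / 4 + b + 1 / e.
      have -> : e * a / 4 + b + 1 / e =
          e^-1 * (e / 2 * (e / 2 * a + b) + (e / 2 * b + 1)).
        by field; rewrite gt_eqF.
      by apply: mulr_ge0; [rewrite invr_ge0 ltW|move: h; lra].
    move: fq; move: (1 / e) => i; lra.
  exists p; last first.
    move=> q; apply: le_trans (pmax q) _; rewrite /f lerBlDr lerDl.
    by rewrite mulr_ge0 ?divr_ge0 ?dotr_ge0// ltW.
  have drho (s : R) : is_derive s (1 : R) (fun s => - e * s) (- e).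
    have := is_deriveZ (- e) (is_derive_id s (1 : R)).
    by move/is_derive_eq; apply; rewrite [_ *: 1]mulr1.
  have := local_max_inequality X_isometric N_normal X_weakly_convex X_shrinker
    (p := p) (y := 0) drho (fun s => is_derive_cst (- e) s (1 : R)).
  case=> [|E [_]].
    by apply: nearW => q; rewrite !subr0 !mulNr; exact: pmax.
  have XN : dotr (X p) (N p) = - K p by rewrite X_shrinker opprK.
  rewrite subr0 mul0r addr0 -sigma_pred// XN.
  have := HK p; have := gauss_kronecker_ge0 p; have := sC p.
  have n1 : (1 : R) <= n%:R by rewrite ler1n.
  set s := sigma _ _ _ _ _; set k := K p; set a := dotr (X p) (X p).
  move=> sCp k0 HKp h.
  have kn : 0 <= k * (n%:R - H p * k) by rewrite mulr_ge0// subr_ge0.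
  have nk : 0 <= (n%:R - 1) * k ^+ 2 by rewrite mulr_ge0 ?sqr_ge0// subr_ge0.
  have : e * (s + n%:R * k * - k - (a + k * - k)) >= 0 by lra.
  rewrite pmulr_rge0//; nra.
have [p0 p0C _] := ex_eps 1 ltr01.
have cB := X_proper.2 _ (@euclidean_ball_compact R n.+1 C).
have [||p _ pmax] := compact_EVT_max (f := K) _ cB.
- by exists p0.
- exact/continuous_subspaceT/gauss_kronecker_continuous.
have no_gap (r t t' b : R) : 0 < b + 1 -> t < r ->
    r - (r - t) / (b + 1) * (b / 2) <= t' -> t' <= t -> False.
  move=> b1 tr; have d0 : 0 < (r - t) / (b + 1) by rewrite divr_gt0// subr_gt0.
  have -> : (r - t) / (b + 1) * (b / 2) = (r - t) / 2 - (r - t) / (b + 1) / 2.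
    by field; rewrite gt_eqF.
  by move: ((r - t) / (b + 1)) d0 => d; lra.
exists p => q; rewrite leNgt; apply/negP => pq.
have a1 : 0 < dotr (X q) (X q) + 1 by rewrite ltr_wpDl// dotr_ge0.
have z0 : 0 < (K q - K p) / (dotr (X q) (X q) + 1) by rewrite divr_gt0// subr_gt0.
have [p' p'C /(_ q) h1] := ex_eps _ z0.
have h2 : K p' <= K p by apply/pmax/mem_set.
exact: no_gap a1 pq h1 h2.
Qed.

End GlobalMaximum.

(** * Chords of the immersion *)

(** Entrywise errors [eta] change the form by at most [n * eta] times the sum
    of the squares, since [c j * c k] is at most the mean of the two squares. *)
Lemma near_identity_form {R : realType} n (c : 'I_n -> R) (T : 'I_n -> 'I_n -> R) (eta : R) :
  n%:R * eta < 1 -> (forall j k, `|T j k - (j == k)%:R| <= eta) ->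
  \sum_j \sum_k c j * c k * T j k = 0 -> forall j, c j = 0.
Proof.
move=> eta1 Teta T0.
pose q := \sum_j c j ^+ 2.
have q0 : 0 <= q by apply: sumr_ge0 => j _; exact: sqr_ge0.
have diag : \sum_j \sum_k c j * c k * (j == k)%:R = q.
  apply: eq_bigr => j _; rewrite (bigD1 j)//= big1 ?addr0 ?eqxx ?mulr1 ?expr2//.
  by move=> k kj; rewrite eq_sym (negPf kj) mulr0.
have bound : - \sum_j \sum_k c j * c k * (T j k - (j == k)%:R) <=
    \sum_(j < n) \sum_(k < n) eta * ((c j ^+ 2 + c k ^+ 2) / 2).
  rewrite -sumrN; apply: ler_sum => j _; rewrite -sumrN; apply: ler_sum => k _.
  have := Teta j k; rewrite ler_norml; move: (T j k - _) => d /andP[d1 d2].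
  have := sqr_ge0 (c j + c k); have := sqr_ge0 (c j - c k); nra.
have sumE : \sum_(j < n) \sum_(k < n) eta * ((c j ^+ 2 + c k ^+ 2) / 2) =
    n%:R * eta * q.
  rewrite (eq_bigr (fun j => eta * ((n%:R * c j ^+ 2 + q) / 2))) => [|j _].
    rewrite -mulr_sumr -mulr_suml big_split /= -mulr_sumr sumr_const card_ord.
    by rewrite -mulr_natl -/q; field.
  by rewrite -mulr_sumr -mulr_suml big_split /= sumr_const card_ord -[c j ^+ 2 *+ n]mulr_natl.
have TE : \sum_j \sum_k c j * c k * (T j k - (j == k)%:R) = - q.
  have -> : - q = (\sum_j \sum_k c j * c k * T j k) -
      \sum_j \sum_k c j * c k * (j == k)%:R by rewrite T0 diag sub0r.
  rewrite -sumrB; apply: eq_bigr => j _.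
  by rewrite -sumrB; apply: eq_bigr => k _; rewrite mulrBr.
have qE : q = 0.
  move: bound; rewrite TE opprK sumE => qle.
  have : (1 - n%:R * eta) * q <= 0 by rewrite mulrBl mul1r subr_le0.
  by rewrite pmulr_rle0 ?subr_gt0// => qle0; apply/le_anti; rewrite q0 qle0.
move=> j; apply/eqP; rewrite -sqrf_eq0.
by move/eqP: qE; rewrite psumr_eq0 => [/allP/(_ j (mem_index_enum j))//|k _]; exact: sqr_ge0.
Qed.

Lemma dotr_sum2 {R : realType} {m n} (c : 'I_n -> R) (F G : 'I_n -> 'rV[R]_m) :
  dotr (\sum_j c j *: F j) (\sum_k c k *: G k) =
  \sum_j \sum_k c j * c k * dotr (F j) (G k).
Proof.
rewrite dotr_suml; apply: eq_bigr => j _; rewrite dotr_sumr.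
by apply: eq_bigr => k _; rewrite dotrZl dotrZr mulrA.
Qed.

Lemma chord_form {R : realType} {m n} (c : 'I_n -> R) (F G D : 'I_n -> 'rV[R]_m) z :
  dotr (\sum_j c j *: F j) (\sum_k c k *: G k) =
    dotr (\sum_j c j *: D j) z * dotr z (\sum_k c k *: G k) ->
  \sum_j \sum_k c j * c k * (dotr (F j) (G k) - dotr (D j) z * dotr z (G k)) = 0.
Proof.
rewrite dotr_sum2 dotr_suml dotr_sumr big_distrlr /= => E.
under eq_bigr do (under eq_bigr do rewrite mulrBr; rewrite sumrB).
rewrite sumrB E; apply/eqP; rewrite subr_eq0; apply/eqP.
apply: eq_bigr => j _; apply: eq_bigr => k _.
by rewrite dotrZl dotrZr mulrACA.
Qed.

Lemma small_perturbation {R : realType} {m} (eta a q d : R) (f z : 'rV[R]_m) :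
  dotr z z = 1 -> dotr f f < 3 -> `|q| < eta -> `|a - d| < eta ->
  `|a - dotr f z * q - d| <= 3 * eta.
Proof.
move=> zz ff qe ade.
have p2 : `|dotr f z| <= 2.
  have := dotr_ge0 (f - z); have := dotr_ge0 (f + z).
  rewrite !(dotrDl, dotrDr, dotrNl, dotrNr) zz (dotrC z f) => h1 h2.
  by rewrite ler_norml; apply/andP; split; lra.
have -> : a - dotr f z * q - d = (a - d) - dotr f z * q by ring.
apply: le_trans (ler_normB _ _) _; rewrite normrM.
have := normr_ge0 (dotr f z); have := normr_ge0 q; nra.
Qed.

Lemma convex_lt {R : realType} (a b r t : R) : 0 <= t -> t <= 1 ->
  a < r -> b < r -> t * a + (1 - t) * b < r.
Proof.
move=> t0 t1 ar br; have [ab|ba] := leP a b.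
  by apply: le_lt_trans br; nra.
by apply: le_lt_trans ar; nra.
Qed.

Section LocalInjectivity.
Context {R : realType} {n : nat} {M : topologicalType}.
Context {S : smooth_atlas R n M} {g : riemannian_metric S}.
Context {X N : M -> 'rV[R]_n.+1}.
Hypothesis X_isometric : isometric_immersion g X.
Hypothesis N_normal : unit_normal_field S X N.

Local Notation x i := (X \o param i).
Local Notation nu i := (N \o param i).
Implicit Types (i : chart S) (u v w : 'rV[R]_n).

Lemma is_derive_dotr_cst i u v a : cod i u ->
  is_derive u v (fun t => dotr (x i t) a) (dotr ('D_v (x i) u) a).
Proof.
move=> iu.
have := is_derive_dotr (is_derive_position X_isometric v iu) (is_derive_cst a u v).
by move/is_derive_eq; apply; rewrite dotr0r addr0.
Qed.

(** Strict differentiability in scalar form. If a chord is [l *: nu], the mean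
    value theorem is applied to its products with [nu], which gives [l], and
    with the image of [u - u'] at [u0]; as tangent and normal vectors vary
    little, these values force a definite form to vanish on [u - u']. *)
Lemma chord_not_normal i u0 : cod i u0 -> exists2 r : R, 0 < r &
  (forall u, ball u0 r u -> cod i u) /\
  (forall u u' (l : R), ball u0 r u -> ball u0 r u' ->
    x i u - x i u' = l *: nu i u' -> u = u').
Proof.
move=> iu0.
have [e [d [ee _]]] := exists_diagonal_frame X_isometric N_normal iu0.
pose eta : R := (3 * (n%:R + 1))^-1.
have n1 : (0 : R) < n%:R + 1 by rewrite ltr_wpDl.
have eta0 : 0 < eta by rewrite invr_gt0 mulr_gt0.
have eta3 : n%:R * (3 * eta) < 1.
  have : (n%:R + 1) * (3 * eta) = 1.
    by rewrite /eta; field; rewrite gt_eqF.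
  lra.
have cx k : {for u0, continuous ('D_(e k) (x i))}.
  exact: (position_smooth X_isometric i 1).2 (e k) u0 iu0.
have cn : {for u0, continuous (nu i)} := normal_smooth X_isometric N_normal i 0 u0 iu0.
have fnb := nbhs_filter u0.
have near1 : \forall t \near u0, forall jk : 'I_n * 'I_n,
    `|dotr ('D_(e jk.1) (x i) t) ('D_(e jk.2) (x i) u0) - (jk.1 == jk.2)%:R| < eta.
  apply: (@filter_forall _ _ _ (nbhs u0) fnb) => -[j k] /=.
  have : (fun t => dotr ('D_(e j) (x i) t) ('D_(e k) (x i) u0)) @ u0 --> ((j == k)%:R : R).
    have <- := ee j k; apply: (@cvg_dotr _ _ (nbhs u0) fnb _ _ (cst _)).
      exact: cx.
    exact: cvg_cst.
  by move/cvgrPdist_lt => /(_ _ eta0); apply: filterS => t; rewrite distrC.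
have near2 : \forall t \near u0, forall j : 'I_n,
    dotr ('D_(e j) (x i) t) ('D_(e j) (x i) t) < 3.
  apply: (@filter_forall _ _ _ (nbhs u0) fnb) => j.
  have c : (fun t => dotr ('D_(e j) (x i) t) ('D_(e j) (x i) t)) @ u0 --> (1 : R).
    have <- : dotr ('D_(e j) (x i) u0) ('D_(e j) (x i) u0) = 1.
      by apply: etrans (ee j j) _; rewrite eqxx.
    by apply: (@cvg_dotr _ _ (nbhs u0) fnb); exact: cx.
  by apply: (cvgr_lt _ c); rewrite ltr1n.
have near3 : \forall t \near u0, forall k : 'I_n,
    `|dotr (nu i t) ('D_(e k) (x i) u0)| < eta.
  apply: (@filter_forall _ _ _ (nbhs u0) fnb) => k.
  have c : (fun t => dotr (nu i t) ('D_(e k) (x i) u0)) @ u0 --> (0 : R).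
    have <- : dotr (nu i u0) ('D_(e k) (x i) u0) = 0.
      by rewrite dotrC; exact: (tangent_normal N_normal).
    apply: (@cvg_dotr _ _ (nbhs u0) fnb _ _ (cst _)); first exact: cn.
    exact: cvg_cst.
  by move/cvgrPdist_lt : c => /(_ _ eta0); apply: filterS => t; rewrite sub0r normrN.
have [r /= r0 rP] := (nbhs_ballP _ _).1 (filterI (near_cod iu0)
  (filterI near1 (filterI near2 near3))).
exists r => //; split=> [u /rP[]//|u u' l ru ru' chord].
have seg t : 0 <= t <= 1 -> ball u0 r (t *: (u - u') + u').
  move=> /andP[t0 t1]; move: ru ru'; rewrite -!ball_normE /= => ru ru'.
  have -> : u0 - (t *: (u - u') + u') = t *: (u0 - u) + (1 - t) *: (u0 - u').
    by apply/rowP => k; rewrite !mxE; ring.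
  apply: le_lt_trans (ler_normD _ _) _; rewrite !normrZ (ger0_norm t0).
  by rewrite ger0_norm ?subr_ge0//; exact: convex_lt.
have mvt a : exists2 t, ball u0 r t & dotr (x i u - x i u') a = dotr ('D_(u - u') (x i) t) a.
  have [|t t01] := @mean_value_line _ _ (fun t => dotr (x i t) a) u' (u - u').
    move=> t /seg/rP[it _].
    have op := @cod_open _ _ _ S i.
    have [dk _] := Ck_dotr op (position_smooth X_isometric i 1) (Ck_cst op 1 a).
    exact: dk.
  rewrite subrK -dotrBl => E; exists (t *: (u - u') + u').
    by apply: seg; case/andP: t01 => ? ?; rewrite !ltW.
  rewrite E; have [|_ ->//] := @is_derive_dotr_cst i (t *: (u - u') + u') (u - u') a.
  by apply: (rP _ _).1; apply: seg; case/andP: t01 => ? ?; rewrite !ltW.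
have [c vE] : exists c : 'I_n -> R, u - u' = \sum_j c j *: e j.
  have uE := frame_unitmx X_isometric iu0 ee.
  exists (fun j => ((u - u') *m invmx (\matrix_j e j)) 0 j).
  rewrite -{1}(mulmxKV uE (u - u')) mulmx_sum_row.
  by apply: eq_bigr => j _; rewrite rowK.
have Dv t : cod i t -> 'D_(u - u') (x i) t = \sum_j c j *: 'D_(e j) (x i) t.
  by move=> it; rewrite vE; exact: (position_derive_sum X_isometric).
have [t1 /rP[it1 [T1 _]]] := mvt ('D_(u - u') (x i) u0).
have [t2 /rP[it2 [_ [T2 _]]]] := mvt (nu i u').
have [_ [_ [_ T3]]] := rP _ ru'.
rewrite chord !dotrZl (normal_unit N_normal) mulr1 (Dv _ it2) => -> {l chord}.
rewrite (Dv _ it1) (Dv _ iu0) => E.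
pose T j k := dotr ('D_(e j) (x i) t1) ('D_(e k) (x i) u0) -
  dotr ('D_(e j) (x i) t2) (nu i u') * dotr (nu i u') ('D_(e k) (x i) u0).
have T0 : \sum_j \sum_k c j * c k * T j k = 0.
  exact: (chord_form (esym E)).
have TI j k : `|T j k - (j == k)%:R| <= 3 * eta.
  exact: small_perturbation (normal_unit N_normal i u') (T2 j) (T3 k) (T1 (j, k)).
have c0 := near_identity_form eta3 TI T0.
apply/eqP; rewrite -subr_eq0 vE big1// => j _.
by rewrite c0 scale0r.
Qed.

End LocalInjectivity.

(** * Zero curvature *)

Section CriticalPoints.
Context {R : realType} {n : nat} {M : topologicalType}.
Context {S : smooth_atlas R n M} {g : riemannian_metric S}.
Context {X N : M -> 'rV[R]_n.+1}.
Hypothesis X_isometric : isometric_immersion g X.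
Hypothesis N_normal : unit_normal_field S X N.
Hypothesis X_proper : proper_map X.
Hypothesis M_connected : connected [set: M].
Hypothesis M_nonempty : [set: M] !=set0.

Local Notation x i := (X \o param i).
Local Notation nu i := (N \o param i).
Local Notation K := (gauss_kronecker S X N).
Implicit Types (i : chart S) (u v w : 'rV[R]_n).

(** Squared distances of both the position and the normal are allowed, in
    order to follow points together with their normals. *)
Lemma minimum_critical i u v y b (c : R) : cod i u ->
  (forall q, dotr (x i u - y) (x i u - y) / 2 + c * (dotr (nu i u - b) (nu i u - b) / 2) <=
    dotr (X q - y) (X q - y) / 2 + c * (dotr (N q - b) (N q - b) / 2)) ->
  dotr (x i u - y) ('D_v (x i) u) + c * dotr (nu i u - b) ('D_v (nu i) u) = 0.
Proof.
move=> iu umin.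
pose f t := - (dotr (x i t - y) (x i t - y) / 2 +
  c * (dotr (nu i t - b) (nu i t - b) / 2)).
have d1 := is_derive_half_square y (is_derive_position X_isometric v iu).
have d2 := is_derive_half_square b (is_derive_normal X_isometric N_normal v iu).
have df := is_deriveN (is_deriveD d1 (is_deriveZ c d2)).
have op := @cod_open _ _ _ S i.
have Cx : Ck 1 (cod i) (fun t => x i t - y).
  exact: (CkD op (position_smooth X_isometric i 1) (Ck_cst op 1 (- y : 'rV[R]_n.+1))).
have Cn : Ck 1 (cod i) (fun t => nu i t - b).
  exact: (CkD op (normal_smooth X_isometric N_normal i 1) (Ck_cst op 1 (- b : 'rV[R]_n.+1))).
have C2 := Ck_cst op 1 (2^-1 : R).
have [dfu _] := CkM op (Ck_cst op 1 (-1 : R)) (CkD op (CkM op (Ck_dotr op Cx Cx) C2)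
  (CkM op (Ck_cst op 1 c) (CkM op (Ck_dotr op Cn Cn) C2))).
have fE : f = (fun t => -1 * (dotr (x i t - y) (x i t - y) / 2 +
  c * (dotr (nu i t - b) (nu i t - b) / 2))).
  by apply/funext => t; rewrite /f mulN1r.
have dfu' : differentiable f u by rewrite fE; exact: dfu.
have fmax : \forall t \near u, f t <= f u.
  have all t : f t <= f u by rewrite /f lerN2; exact: umin.
  exact: (@filterE _ _ (nbhs_filter u) _ all).
have := derive_local_max v dfu' fmax.
have [_ E] := df.
by move=> E0; rewrite E0 in E; apply/eqP; rewrite -oppr_eq0 -E.
Qed.

Lemma minimum_exists y b (c : R) : 0 <= c -> exists p, forall q,
  dotr (X p - y) (X p - y) / 2 + c * (dotr (N p - b) (N p - b) / 2) <=
  dotr (X q - y) (X q - y) / 2 + c * (dotr (N q - b) (N q - b) / 2).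
Proof.
move=> c0; have [q0 _] := M_nonempty.
pose f q := dotr (X q - y) (X q - y) / 2 + c * (dotr (N q - b) (N q - b) / 2).
have cX := continuous_position X_proper.
have cN := continuous_normal N_normal.
have cf : continuous (fun q => - f q).
  move=> q; apply: cvgN; apply: cvgD.
    apply: cvgMl; apply: (@cvg_dotr _ _ (nbhs q)); apply: cvgB;
      by [exact: cX|exact: cvg_cst].
  apply: cvgMr; apply: cvgMl; apply: (@cvg_dotr _ _ (nbhs q)); apply: cvgB;
    by [exact: cN|exact: cvg_cst].
have [|p pmax] := proper_max X_proper (q0 := q0) (b := 4 * f q0 + 2 * dotr y y) cf.
  move=> q; rewrite ltrN2 => fq.
  have : dotr (X q - y) (X q - y) / 2 <= f q.
    by rewrite /f lerDl mulr_ge0// divr_ge0// dotr_ge0.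
  have := dotr_ge0 (X q - 2 *: y).
  rewrite !(dotrDl, dotrDr, dotrNl, dotrNr, dotrZl, dotrZr) (dotrC y).
  lra.
by exists p => q; have := pmax q; rewrite lerN2.
Qed.

Lemma zero_isolated p : X p = 0 -> \forall q \near p, X q = 0 -> q = p.
Proof.
move=> Xp; pose i := chart_at S p.
have ip : dom i p by exact: chart_atP.
have iu : cod i (Defs.coord i p) by exact: coord_cod.
have [r r0 [rcod rinj]] := chord_not_normal X_isometric N_normal iu.
have near_dom : \forall q \near p, dom i q.
  by apply: open_nbhs_nbhs; split => //; exact: dom_open.
have near_ball : \forall q \near p, ball (Defs.coord i p) r (Defs.coord i q).
  have cc : Defs.coord i @ p --> Defs.coord i p := Defs.coord_continuous ip.
  exact: (cc _ (nbhsx_ballx (Defs.coord i p) r r0)).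
apply: filterS (filterI near_dom near_ball) => q [iq rq] Xq.
rewrite -(coordK ip) -(coordK iq); congr (param i _).
apply: (rinj _ _ 0 rq (ballxx _ r0)).
by rewrite /= !coordK// Xp Xq subr0 scale0r.
Qed.

Section ZeroCurvature.
Hypothesis K_eq0 : forall p, K p = 0.
Hypothesis X_shrinker : gauss_self_shrinker S X N.

Lemma support_eq0 p : dotr (X p) (N p) = 0.
Proof. by have := X_shrinker p; rewrite K_eq0 => /eqP; rewrite eq_sym oppr_eq0 => /eqP. Qed.

(** As the support function vanishes, so do its derivatives, which are the
    products of the position with the derivatives of the normal. *)
Lemma radial_direction i u : cod i u ->
  exists2 w, 'D_w (x i) u = x i u & 'D_w (nu i) u = 0.
Proof.
move=> iu; have [e [d [ee _]]] := exists_diagonal_frame X_isometric N_normal iu.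
have [w xw] := tangent_lift X_isometric N_normal (x i u) iu ee.
have {}xw : 'D_w (x i) u = x i u by rewrite xw support_eq0 scale0r subr0.
exists w => //.
have Xnu v : dotr (x i u) ('D_v (nu i) u) = 0.
  have := is_derive_near_cst (c := 0) iu _ (is_derive_support X_isometric N_normal v iu).
  move=> /(_ (fun t _ => etrans (congr1 -%R (support_eq0 (param i t))) (oppr0 _)))/eqP.
  by rewrite oppr_eq0 => /eqP.
rewrite [LHS](frame_expansion N_normal iu ee).
rewrite (normal_derive_orthogonal X_isometric N_normal w iu) scale0r addr0 big1// => j _.
rewrite (second_form_sym X_isometric N_normal w (e j) iu) xw dotrC Xnu.
by rewrite scale0r.
Qed.

(** Moving the target from [t X(q)] towards the origin costs only to second
    order: at a minimum of the penalised distance the first order term has a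
    sign, because the radial direction changes neither the normal nor, up to
    scale, the position. *)
Lemma radial_step q (t h : R) : 0 < t -> 0 <= h ->
  exists p, forall p',
    dotr (X p - (t - h) *: X q) (X p - (t - h) *: X q) + dotr (N p - N q) (N p - N q) <=
    dotr (X p' - t *: X q) (X p' - t *: X q) + dotr (N p' - N q) (N p' - N q) +
    h ^+ 2 * dotr (X q) (X q).
Proof.
move=> t0 h0; have [p pmin] := minimum_exists (t *: X q) (N q) ler01.
exists p => p'.
pose i := chart_at S p; pose u := Defs.coord i p.
have ip : dom i p by exact: chart_atP.
have iu : cod i u by exact: coord_cod.
have pu : param i u = p by exact: coordK.
have [w xw nw] := radial_direction iu.
have pmin' : forall q', dotr (x i u - t *: X q) (x i u - t *: X q) / 2 +
    1 * (dotr (nu i u - N q) (nu i u - N q) / 2) <=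
    dotr (X q' - t *: X q) (X q' - t *: X q) / 2 +
    1 * (dotr (N q' - N q) (N q' - N q) / 2).
  by move=> q'; rewrite /= pu; exact: pmin.
have := minimum_critical w iu pmin'.
rewrite xw nw dotr0r mulr0 addr0 /= pu.
have := pmin p'; rewrite !mul1r.
move: (dotr (N p - N q) _) (dotr (N p' - N q) _) (dotr (X p' - _) _) => a b c.
rewrite !(dotrDl, dotrDr, dotrNl, dotrNr, dotrZl, dotrZr) (dotrC (X q) (X p)).
have := dotr_ge0 (X p - t *: X q).
rewrite !(dotrDl, dotrDr, dotrNl, dotrNr, dotrZl, dotrZr) (dotrC (X q) (X p)).
move: (dotr (X p) (X p)) (dotr (X p) (X q)) (dotr (X q) (X q)) => r s l.
move=> h1 h2 h3.
have : t * (s - t * l) <= 0 by lra.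
rewrite pmulr_rle0// => h4.
have : 0 <= h * (t * l - s) by rewrite mulr_ge0//; lra.
lra.
Qed.

(** The position is contracted from [X q] to 0 in [L + 1] steps of size [h]
    with the normal kept at [N q]. Each step loses at most [h ^+ 2 * C], so the
    total loss [(L + 1) * h ^+ 2 * C = C / (L + 1)] tends to 0, and the minimum
    for the target 0 is exactly 0. This replaces the flow of the radial field. *)
Lemma exists_zero_with_normal q : exists2 p, X p = 0 & N p = N q.
Proof.
pose phi t p := dotr (X p - t *: X q) (X p - t *: X q) + dotr (N p - N q) (N p - N q).
pose C := dotr (X q) (X q).
have C0 : 0 <= C := dotr_ge0 _.
have steps (L : nat) : exists p, phi 0 p <= C / L.+1%:R.
  pose h : R := L.+1%:R^-1.
  have h0 : 0 < h by rewrite invr_gt0 ltr0n.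
  have hL : L.+1%:R * h = 1 by rewrite mulfV// pnatr_eq0.
  suff ih : forall k, (k <= L.+1)%N -> exists p, phi (1 - k%:R * h) p <= k%:R * h ^+ 2 * C.
    have [p] := ih L.+1 (leqnn _); rewrite hL subrr => pL; exists p.
    by apply: le_trans pL _; rewrite expr2 mulrA hL mul1r mulrC.
  elim=> [_|k IH kL].
    by exists q; rewrite /phi !mul0r subr0 scale1r !subrr !dotr0l addr0.
  have [p' p'k] := IH (ltnW kL).
  have t0 : 0 < 1 - k%:R * h.
    have : k%:R * h < L.+1%:R * h by rewrite ltr_pM2r// ltr_nat.
    by rewrite hL subr_gt0.
  have [p pk] := radial_step q t0 (ltW h0).
  exists p; have := pk p'; rewrite -/(phi _ p') -/C.
  have -> : 1 - k%:R * h - h = 1 - k.+1%:R * h by rewrite -natr1; ring.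
  rewrite -/(phi _ p) => hp; apply: le_trans hp _.
  have -> : k.+1%:R * h ^+ 2 * C = k%:R * h ^+ 2 * C + h ^+ 2 * C by rewrite -natr1; ring.
  by rewrite lerD2r.
have [p pmin] := minimum_exists 0 (N q) ler01.
have a0 := dotr_ge0 (X p); have b0 := dotr_ge0 (N p - N q).
have m0 : dotr (X p) (X p) + dotr (N p - N q) (N p - N q) <= 0.
  rewrite leNgt; apply/negP; set m := _ + _ => m0.
  have [p' p'L] := steps (Num.bound (C / m)).
  have := pmin p'; move: p'L; rewrite /phi scale0r !subr0 !mul1r -!mulrDl.
  rewrite -/m => h1 h2.
  have : m <= C / (Num.bound (C / m)).+1%:R by apply: le_trans h1; lra.
  rewrite ler_pdivlMr ?ltr0n// => h3.
  have := @archi_boundP _ (C / m) (divr_ge0 C0 (ltW m0)).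
  rewrite ltr_pdivrMr// => h4.
  have h5 : ((Num.bound (C / m))%:R : R) <= (Num.bound (C / m)).+1%:R by rewrite ler_nat.
  nra.
exists p; first by apply: dotr_eq0; lra.
by apply/eqP; rewrite -subr_eq0; apply/eqP/dotr_eq0; lra.
Qed.

(** All values of the normal are taken at zeros of the position, which are
    isolated and form a compact set. Hence the zeros with another normal than
    [N p0] form a compact set, and the level set of [N p0] is open. *)
Lemma normal_constant p0 p : N p = N p0.
Proof.
have cX := continuous_position X_proper.
have cN := continuous_normal N_normal.
have closed1 (y : 'rV[R]_n.+1) : closed [set y].
  exact: compact_closed (@norm_hausdorff _ _) (@compact_set1 _ y).
pose Z1 : set M := [set q | X q = 0 /\ N q <> N p0].
have Z1closed : closed Z1.
  move=> q clq.
  have Xq : X q = 0.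
    have c0 : closed (X @^-1` [set (0 : 'rV[R]_n.+1)]).
      by apply: preimage_closed (closed1 _) => z _; exact: cX.
    by apply: c0; apply: closureS clq => z [].
  have [z [[Xz Nz] zq]] := clq _ (zero_isolated Xq).
  by rewrite -(zq Xz).
have Z1compact : compact Z1.
  have c0 := X_proper.2 [set (0 : 'rV[R]_n.+1)] (@compact_set1 _ _).
  by apply: (@subclosed_compact _ Z1 _ Z1closed c0) => z [].
have NZ1 : closed (N @` Z1).
  apply: compact_closed (@norm_hausdorff _ _) _.
  by apply: continuous_compact => //; exact: continuous_subspaceT.
pose A : set M := [set q | N q = N p0].
have AE : A = ~` (N @^-1` (N @` Z1)).
  apply/seteqP; split=> [q Aq [z [_ Nz] zq]|q nq].
    by apply: Nz; rewrite zq.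
  apply: contrapT => Nq; apply: nq.
  have [z Xz Nz] := exists_zero_with_normal q.
  by exists z => //; split => //; rewrite Nz.
have : A = [set: M].
  apply: M_connected; first by exists p0.
  - exists A; last by rewrite setTI.
    rewrite AE; apply: closed_openC.
    by apply: preimage_closed NZ1 => z _; exact: cN.
  - exists A; last by rewrite setTI.
    by apply: preimage_closed (closed1 (N p0)) => z _; exact: cN.
by move=> AT; have : A p by rewrite AT.
Qed.

(** With a constant normal the image lies in a hyperplane through the origin;
    it is all of it, because the segment from a point [y] of the hyperplane to a
    nearest point of the image is both normal and tangent. *)
Lemma zero_curvature_hyperplane : is_hyperplane X.
Proof.
have [p0 _] := M_nonempty; exists (N p0), 0; split.
  apply/eqP => N0; have := normal_dotr1 N_normal p0.
  by rewrite N0 dotr0l => /eqP; rewrite eq_sym oner_eq0.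
apply/seteqP; split=> [_ [p _ <-] /=|y /= Ny].
  by rewrite -(normal_constant p0 p) dotrC support_eq0.
have [p pmin] := minimum_exists y 0 (lexx 0).
exists p => //; apply/eqP; rewrite -subr_eq0; apply/eqP.
pose i := chart_at S p; pose u := Defs.coord i p.
have ip : dom i p by exact: chart_atP.
have iu : cod i u by exact: coord_cod.
have pu : param i u = p by exact: coordK.
have [e [d [ee _]]] := exists_diagonal_frame X_isometric N_normal iu.
have pmin' : forall q', dotr (x i u - y) (x i u - y) / 2 +
    0 * (dotr (nu i u - 0) (nu i u - 0) / 2) <=
    dotr (X q' - y) (X q' - y) / 2 + 0 * (dotr (N q' - 0) (N q' - 0) / 2).
  by move=> q'; rewrite /= pu; exact: pmin.
rewrite (frame_expansion N_normal iu ee (X p - y)) big1 => [|j _].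
  rewrite /= pu dotrBl support_eq0 (normal_constant p0 p) (dotrC y) Ny.
  by rewrite subrr scale0r addr0.
have := minimum_critical (e j) iu pmin'.
by rewrite mul0r addr0 /= pu => ->; rewrite scale0r.
Qed.

End ZeroCurvature.
End CriticalPoints.

(** * Consequences of the inequality where the curvature is positive *)

Section PositiveMaximum.
Context {R : realType} {n : nat} {M : topologicalType}.
Context {S : smooth_atlas R n M} {g : riemannian_metric S}.
Context {X N : M -> 'rV[R]_n.+1}.
Hypothesis n_gt0 : (0 < n)%N.
Hypothesis X_isometric : isometric_immersion g X.
Hypothesis N_normal : unit_normal_field S X N.
Hypothesis X_proper : proper_map X.
Hypothesis X_weakly_convex : weakly_convex g X N.
Hypothesis X_shrinker : gauss_self_shrinker S X N.

Local Notation x i := (X \o param i).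
Local Notation nu i := (N \o param i).
Local Notation curv p := (tnth (principal_curvatures S X N p)).
Local Notation K := (gauss_kronecker S X N).
Local Notation H := (mean_curvature S X N).
Implicit Types (i : chart S) (u v w : 'rV[R]_n).

Variable C : R.
Hypothesis sigma_le : forall p, sigma S X N n.-1 p <= C.
Hypothesis HK_le : forall p, H p * K p <= n%:R.

(** The evolution inequality with [rho = 0] reads [K (n - H K) <= 0], opposite to
    the hypothesis. *)
Lemma max_HK p : (forall q, K q <= K p) -> 0 < K p -> H p * K p = n%:R.
Proof.
move=> pmax Kp.
have d0 (s : R) : is_derive s (1 : R) (fun=> 0 : R) 0 by exact: is_derive_cst.
have [|E [_]] := local_max_inequality X_isometric N_normal X_weakly_convex X_shrinker
  (p := p) (y := 0) d0 d0.
  have all q : K q + 0 <= K p + 0 by rewrite !lerD2r.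
  exact: (nearW _ all).
rewrite !mul0r !addr0 pmulr_rle0// subr_le0 => h.
by apply/le_anti; rewrite HK_le h.
Qed.

(** The derivative of the support function in a principal direction is the
    curvature times the component of the position, and no curvature vanishes
    where the product [K] is positive. *)
Lemma max_position p : (forall q, K q <= K p) -> 0 < K p -> X p = - (K p *: N p).
Proof.
move=> pmax Kp.
have [e [ee ed]] := principal_frame X_isometric N_normal p.
move: ee ed; set i := chart_at S p; set u := Defs.coord i p => ee ed.
have ip : dom i p by exact: chart_atP.
have iu : cod i u by exact: coord_cod.
have pu : param i u = p by exact: coordK.
pose f t := - dotr (x i t) (nu i t).
have op := @cod_open _ _ _ S i.
have [df _] := CkM op (Ck_cst op 1 (-1 : R)) (Ck_dotr op (position_smooth X_isometric i 1)
  (normal_smooth X_isometric N_normal i 1)).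
have fE : f = (fun t => -1 * dotr (x i t) (nu i t)).
  by apply/funext => t; rewrite /f mulN1r.
have df' : differentiable f u by rewrite fE; exact: df.
have fmax : \forall t \near u, f t <= f u.
  have all t : f t <= f u by rewrite /f /= -!X_shrinker pu; exact: pmax.
  exact: (@filterE _ _ (nbhs_filter u) _ all).
have Xe j : dotr (x i u) ('D_(e j) (x i) u) = 0.
  have := derive_local_max (e j) df' fmax.
  have [_ ->] := is_derive_support X_isometric N_normal (e j) iu.
  rewrite (ed j) dotrNr opprK dotrZr => /eqP; rewrite mulf_eq0 => /orP[/eqP c0|/eqP//].
  by move: Kp; rewrite /gauss_kronecker (bigD1 j)//= c0 mul0r ltxx.
have := frame_expansion N_normal iu ee (x i u).
rewrite big1 => [|j _]; last by rewrite Xe scale0r.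
rewrite add0r /= pu => XE; apply: etrans XE _.
by rewrite X_shrinker scaleNr opprK.
Qed.

(** Ellipticity: each weight is [K / k_j >= K / H >= K^2 / n]. *)
Lemma newton_lower_bound p k : 0 < K p ->
  K p ^+ 2 / n%:R <= \prod_(j | j != k) curv p j.
Proof.
move=> Kp; set P := \prod_(j | _) _.
have P0 : 0 <= P.
  by apply: prodr_ge0 => j _; exact: (curvature_ge0 X_isometric N_normal X_weakly_convex).
have cH : curv p k <= H p.
  rewrite /mean_curvature (bigD1 k)//= lerDl; apply: sumr_ge0 => j _.
  exact: (curvature_ge0 X_isometric N_normal X_weakly_convex).
have KE : K p = curv p k * P by rewrite /gauss_kronecker (bigD1 k).
rewrite ler_pdivrMr ?ltr0n//.
have h1 : P * (H p * K p) <= P * n%:R by rewrite ler_wpM2l// HK_le.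
apply: le_trans h1; rewrite mulrCA expr2 {1}KE -mulrA.
by apply: ler_wpM2r cH; rewrite mulr_ge0// ltW.
Qed.

Lemma is_derive_exponential (a b s : R) :
  is_derive s (1 : R) (fun s => b * expR (a * s)) (b * a * expR (a * s)).
Proof.
have d1 : is_derive s (1 : R) (fun s => a * s) a.
  have := is_deriveZ a (is_derive_id s (1 : R)).
  by move/is_derive_eq; apply; rewrite [_ *: 1]mulr1.
have d2 := is_derive1_comp (is_derive_expR (a * s)) d1.
have := is_deriveZ b d2; move/is_derive_eq; apply.
by rewrite /GRing.scale/= -mulrA [a * expR _]mulrC.
Qed.

(** For the exponential barrier the second order term carries a factor [a]
    more than the others, so the inequality bounds [a] by quantities that do
    not depend on it, wherever the chord from [y] is not normal. *)
Lemma exponential_barrier p y (a eps : R) : 0 < a -> 0 < eps -> 0 < K p ->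
  (\forall q \near p, K q + eps * expR (- a * (dotr (X q - y) (X q - y) / 2)) <=
                      K p + eps * expR (- a * (dotr (X p - y) (X p - y) / 2))) ->
  a * (K p ^+ 2 / n%:R) * (dotr (X p - y) (X p - y) - dotr (X p - y) (N p) ^+ 2) <=
  C + n%:R * K p * dotr (X p - y) (N p) -
    (dotr (X p - y) (X p) + K p * dotr (X p - y) (N p)).
Proof.
move=> a0 e0 Kp pmax.
have [//|E [pars]] := local_max_inequality X_isometric N_normal X_weakly_convex X_shrinker
  (p := p) (y := y) (is_derive_exponential (- a) eps)
  (is_derive_exponential (- a) (eps * - a)).
rewrite -(sigma_pred p n_gt0).
set ex := expR _; have ex0 : 0 < ex by exact: expR_gt0.
set D := sigma _ _ _ _ _ + _ - _; set Q := \sum_k _ => ineq.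
have QT : K p ^+ 2 / n%:R * (dotr (X p - y) (X p - y) - dotr (X p - y) (N p) ^+ 2) <= Q.
  rewrite pars addrK mulr_sumr; apply: ler_sum => k _.
  by rewrite ler_wpM2r ?sqr_ge0// newton_lower_bound.
have DC : D <= C + n%:R * K p * dotr (X p - y) (N p) -
    (dotr (X p - y) (X p) + K p * dotr (X p - y) (N p)).
  by rewrite lerB// lerD2r.
apply: le_trans DC; rewrite -mulrA.
apply: le_trans (_ : a * Q <= D); first by rewrite ler_pM2l.
have h1 : 0 <= K p * (n%:R - H p * K p) by rewrite mulr_ge0 ?subr_ge0// ltW.
have h2 : (eps * a * ex) * (a * Q - D) <= 0.
  by apply: le_trans ineq; rewrite -[leLHS]add0r -addrA lerD//; lra.
by rewrite pmulr_rle0 ?subr_le0// in h2; rewrite !mulr_gt0.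
Qed.

End PositiveMaximum.

(** * The strong maximum principle *)

(** A compactness form of perturbation: if [t1] is the only maximum of [k] at
    which [h] is as small as [h t1], then a small multiple of [exp (- a h)]
    moves the maximum of [k] into any given neighbourhood of [t1]. *)
Lemma perturbed_maximum {R : realType} {T : topologicalType} (B V : set T)
    (k h : T -> R) (t1 : T) (a : R) :
  compact B -> open V -> B t1 -> V t1 -> 0 < a ->
  (forall t, B t -> {for t, continuous k}) ->
  (forall t, B t -> {for t, continuous h}) ->
  (forall t, B t -> k t <= k t1) -> (forall t, 0 <= h t) ->
  (forall t, B t -> k t = k t1 -> h t <= h t1 -> t = t1) ->
  exists eps t2, [/\ 0 < eps, B t2, V t2 &
    forall t, B t -> k t + eps * expR (- a * h t) <= k t2 + eps * expR (- a * h t2)].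
Proof.
move=> cB oV Bt1 Vt1 a0 ck ch kmax h0 uniq.
have cBV : compact (B `&` ~` V) by apply: compact_closedI => //; exact: open_closedC.
have [eps eps0 epsP] : exists2 eps : R, 0 < eps & forall t, B t -> ~ V t ->
    k t + eps * expR (- a * h t) < k t1 + eps * expR (- a * h t1).
  have [BV0|BV0] := pselect ((B `&` ~` V) !=set0); last first.
    by exists 1 => // t Bt nVt; exfalso; apply: BV0; exists t.
  pose G t := (k t1 - k t) + Num.max 0 (h t - h t1).
  have cG : {within (B `&` ~` V), continuous G}.
    apply: continuous_in_subspaceT => t /set_mem[Bt _].
    apply: (@cvgD _ _ _ (nbhs t) _ (fun t => k t1 - k t)
      (fun t => Num.max 0 (h t - h t1))).
      by apply: cvgB; [exact: cvg_cst|exact: ck].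
    have cmax := @continuous_max _ _ (cst 0 : T -> R) (fun t => h t - h t1) t.
    apply: cmax; first exact: cvg_cst.
    by apply: cvgB; [exact: ch|exact: cvg_cst].
  have [t0 /set_mem[Bt0 nVt0] t0min] := compact_EVT_min BV0 cBV cG.
  have G0 : 0 < G t0.
    have g1 : 0 <= k t1 - k t0 by rewrite subr_ge0 kmax.
    have g2 : 0 <= Num.max 0 (h t0 - h t1) by rewrite le_max lexx.
    rewrite lt_def addr_ge0// andbT; apply/eqP => G00; apply: nVt0.
    rewrite (uniq t0)//.
      by apply/eqP; rewrite -subr_eq0; apply/eqP; rewrite /G in G00; lra.
    have : h t0 - h t1 <= Num.max 0 (h t0 - h t1) by rewrite le_max lexx orbT.
    rewrite /G in G00; lra.
  exists (G t0 / 2); first by rewrite divr_gt0.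
  move=> t Bt nVt.
  have Gt : G t0 <= G t by apply/t0min/mem_set.
  have e1 : 0 < expR (- a * h t1) := expR_gt0 _.
  have et : expR (- a * h t) <= 1.
    by rewrite -expR0 ler_expR mulNr oppr_le0 mulr_ge0// ltW.
  have kt := kmax t Bt.
  have [ht|ht] := leP (h t) (h t1).
    have mE : Num.max 0 (h t - h t1) = 0 by apply/max_idPl; rewrite subr_le0.
    by move: Gt; rewrite {2}/G mE; nra.
  have : expR (- a * h t) < expR (- a * h t1).
    by rewrite ltr_expR !mulNr ltrN2 ltr_pM2l.
  nra.
have cF : {within B, continuous (fun t => k t + eps * expR (- a * h t))}.
  apply: continuous_in_subspaceT => t /set_mem Bt.
  apply: (@cvgD _ _ _ (nbhs t) _ k (fun t => eps * expR (- a * h t))); first exact: ck.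
  apply: cvgMr; apply: (cvg_comp (fun t => - a * h t) expR); last exact: continuous_expR.
  by apply: cvgMr; exact: ch.
have [t2 /set_mem Bt2 t2max] := compact_EVT_max (ex_intro _ t1 Bt1) cB cF.
exists eps, t2; split=> // [|t Bt]; last exact/t2max/mem_set.
apply: contrapT => nVt2; have := epsP _ Bt2 nVt2; apply/negP; rewrite -leNgt.
exact/t2max/mem_set.
Qed.

(** The ball with diameter from [a] to [y] lies in the ball around [y] through
    [a], and touches its boundary at [a] only. *)
Lemma midpoint_closest {R : realType} {m} (a y z : 'rV[R]_m) :
  dotr (a - y) (a - y) <= dotr (z - y) (z - y) ->
  dotr (z - 2^-1 *: (a + y)) (z - 2^-1 *: (a + y)) <=
    dotr (a - 2^-1 *: (a + y)) (a - 2^-1 *: (a + y)) -> z = a.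
Proof.
move=> h1 h2; apply/eqP; rewrite -subr_eq0; apply/eqP/dotr_eq0/le_anti.
rewrite dotr_ge0 andbT; move: h1 h2.
rewrite !(dotrDl, dotrDr, dotrNl, dotrNr, dotrZl, dotrZr).
rewrite (dotrC z a) (dotrC y a) (dotrC y z).
move: (dotr a a) (dotr a y) (dotr y y) (dotr a z) (dotr z y) (dotr z z) => *.
lra.
Qed.

Lemma tangential_part {R : realType} {m} (z w : 'rV[R]_m) : dotr w w = 1 ->
  dotr z z - dotr z w ^+ 2 = dotr (z - dotr z w *: w) (z - dotr z w *: w).
Proof.
move=> ww; rewrite !(dotrDl, dotrDr, dotrNl, dotrNr, dotrZl, dotrZr) ww (dotrC w z).
ring.
Qed.

(** The triangle inequality: [z] is at most twice as far from [a] as [y] is. *)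
Lemma far_from_boundary {R : realType} {m} (a y z : 'rV[R]_m) (d : R) :
  0 < d -> dotr (y - a) (y - a) < d / 4 ->
  dotr (z - y) (z - y) <= dotr (a - y) (a - y) ->
  d <= dotr (z - a) (z - a) -> False.
Proof.
move=> d0; have := dotr_ge0 (z - a - 2 *: (y - a)).
rewrite !(dotrDl, dotrDr, dotrNl, dotrNr, dotrZl, dotrZr).
rewrite (dotrC z a) (dotrC y a) (dotrC y z).
move: (dotr a a) (dotr a y) (dotr y y) (dotr a z) (dotr z y) (dotr z z) => *.
lra.
Qed.

Section StrongMaximumPrinciple.
Context {R : realType} {n : nat} {M : topologicalType}.
Context {S : smooth_atlas R n M} {g : riemannian_metric S}.
Context {X N : M -> 'rV[R]_n.+1}.
Hypothesis n_gt0 : (0 < n)%N.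
Hypothesis X_isometric : isometric_immersion g X.
Hypothesis N_normal : unit_normal_field S X N.
Hypothesis X_proper : proper_map X.
Hypothesis X_weakly_convex : weakly_convex g X N.
Hypothesis X_shrinker : gauss_self_shrinker S X N.

Local Notation x i := (X \o param i).
Local Notation nu i := (N \o param i).
Local Notation curv p := (tnth (principal_curvatures S X N p)).
Local Notation K := (gauss_kronecker S X N).
Local Notation H := (mean_curvature S X N).
Implicit Types (i : chart S) (u v w : 'rV[R]_n).

Variable C : R.
Hypothesis sigma_le : forall p, sigma S X N n.-1 p <= C.
Hypothesis HK_le : forall p, H p * K p <= n%:R.

(** Hopf's argument. If points [q] with smaller curvature accumulate at [p0],
    take a maximum point [p1] closest to such a [q] and the barrier centred at
    the midpoint [y] of [X p1] and [X q]: it singles out [p1] among the nearby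
    maximum points, so a small multiple of it produces a local maximum near
    [p1], where the barrier inequality fails for large [a]. Distances are
    measured in the ambient space, which requires only that the chord from
    [p1] to [q] is not normal at [p1]. *)
Lemma maximum_set_open p0 : 0 < K p0 -> (forall q, K q <= K p0) ->
  \forall q \near p0, K q = K p0.
Proof.
have half (s t : R) : s / 2 <= t / 2 -> s <= t by lra.
move=> m0 Kmax; apply: contrapT => not_near.
have [m Em] : exists m, K p0 = m by eexists.
rewrite Em in m0 Kmax not_near.
have cX := continuous_position X_proper; have cN := continuous_normal N_normal.
have cK := gauss_kronecker_continuous N_normal X_proper X_shrinker.
have [i [u0 [ip0 iu0 pu0 u0E]]] : exists (i : chart S) (u0 : 'rV[R]_n),
    [/\ dom i p0, cod i u0, param i u0 = p0 & Defs.coord i p0 = u0].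
  exists (chart_at S p0), (Defs.coord (chart_at S p0) p0).
  have ip0 := chart_atP S p0.
  by split => //; [exact: coord_cod|exact: coordK].
have [r r0 [rcod rinj]] := chord_not_normal X_isometric N_normal iu0.
pose B : set 'rV[R]_n := [set u | `|u0 - u| <= r / 2].
have r2 : 0 <= r / 2 by apply: divr_ge0; [exact: ltW|exact: ler0n].
have Bu0 : B u0.
  by rewrite /B /= subrr normr0.
have Bball u : B u -> ball u0 r u.
  rewrite /B -ball_normE /= => h.
  by apply: le_lt_trans h _; rewrite ltr_pdivrMr// ltr_pMr// ltr1n.
have Bcod u : B u -> cod i u by move=> /Bball /rcod.
have cnorm : continuous (fun u : 'rV[R]_n => `|u0 - u|).
  move=> u; apply: (cvg_comp (fun u => u0 - u) (fun u => `|u|)); last exact: norm_continuous.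
  by apply: (@cvgB _ _ _ (nbhs u) _ (cst u0) id); [exact: cvg_cst|exact: cvg_id].
have cB : compact B.
  apply: bounded_closed_compact; last first.
    apply: (@preimage_closed _ _ (fun u : 'rV[R]_n => `|u0 - u|) [set t | t <= r / 2]).
      by move=> u _; exact: cnorm.
    exact: closed_le.
  exists (`|u0| + r / 2); split; first exact: num_real.
  move=> z hz u Bu; apply: le_trans (ltW hz).
  have -> : u = u0 - (u0 - u) by rewrite opprB addrC subrK.
  by apply: le_trans (ler_normB _ _) _; rewrite lerD2l.
have cx u : cod i u -> {for u, continuous (x i)}.
  by move=> iu; exact: (position_smooth X_isometric i 0).
have cpar (f : M -> R) u : continuous f -> cod i u -> {for u, continuous (f \o param i)}.
  by move=> cf iu; apply: continuous_comp; [exact: param_continuous|exact: cf].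
have cdist (f : M -> 'rV[R]_n.+1) y : continuous f ->
    continuous (fun p => dotr (f p - y) (f p - y)).
  move=> cf; apply: continuous_dotr => p; apply: cvgB; by [exact: cf|exact: cvg_cst].
(* the position is injective on the ball, hence leaves [X p0] on its boundary *)
have [d d0 dP] : exists2 d : R, 0 < d & forall u, `|u0 - u| = r / 2 ->
    d <= dotr (x i u - X p0) (x i u - X p0).
  pose D : set 'rV[R]_n := B `&` (fun u => `|u0 - u|) @^-1` [set r / 2].
  have cD : compact D.
    by apply: (compact_preimage cB (@closed_eq _ _)) => u _; exact: cnorm.
  have [D0|D0] := pselect (D !=set0); last first.
    by exists 1 => // u ur; exfalso; apply: D0; exists u; split => //; rewrite /B /= ur.
  have [|u /set_mem[Bu ur] umin] := compact_EVT_min (f := fun u =>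
      dotr (x i u - X p0) (x i u - X p0)) D0 cD.
    apply: continuous_in_subspaceT => u /set_mem[Bu _].
    exact: (cpar (fun p => dotr (X p - X p0) (X p - X p0)) u (cdist _ _ cX) (Bcod u Bu)).
  exists (dotr (x i u - X p0) (x i u - X p0)).
    apply: dotr_gt0; apply/eqP => xu; have : u = u0.
      apply: (rinj _ _ 0 (Bball u Bu) (ballxx _ r0)).
      by rewrite scale0r -xu /= pu0.
    by move=> uu0; move: ur; rewrite /= uu0 subrr normr0 => r3; lra.
  by move=> v vr; apply/umin/mem_set; split => //; rewrite /B /= vr.
have [q [iq rq dq Kq]] : exists q, [/\ dom i q, `|u0 - Defs.coord i q| < r / 2,
    dotr (X q - X p0) (X q - X p0) < d / 4 & K q <> m].
  apply: contrapT => noq; apply: not_near.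
  have near1 : \forall q \near p0, dom i q.
    by apply: open_nbhs_nbhs; split => //; exact: dom_open.
  have near2 : \forall q \near p0, `|u0 - Defs.coord i q| < r / 2.
    have cc : Defs.coord i @ p0 --> u0 by rewrite -u0E; exact: Defs.coord_continuous.
    have r2' : 0 < r / 2 by rewrite divr_gt0.
    exact: ((cvgrPdist_lt _ _).1 cc _ r2').
  have near3 : \forall q \near p0, dotr (X q - X p0) (X q - X p0) < d / 4.
    have := cdist _ (X p0) cX p0; rewrite /continuous_at subrr dotr0l => c0.
    by apply: (cvgr_lt _ c0); rewrite divr_gt0.
  apply: filterS (filterI near1 (filterI near2 near3)) => q [q1 [q2 q3]].
  apply: contrapT => Kq; apply: noq; exists q.
  exact: (And4 q1 q2 q3 Kq).
pose uq := Defs.coord i q.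
have puq : param i uq = q by exact: coordK.
have Buq : B uq by rewrite /B /= ltW.
(* the maximum point closest to [q] *)
pose Z : set 'rV[R]_n := B `&` (K \o param i) @^-1` [set m].
have cZ : compact Z.
  apply: (compact_preimage cB (@closed_eq _ _)) => u Bu.
  exact: (cpar K u cK (Bcod u Bu)).
have Kpu0 : K (param i u0) = m by rewrite pu0.
have Zu0 : Z u0 := conj Bu0 Kpu0.
have [|u1 /set_mem[Bu1 Ku1] u1min] := compact_EVT_min (f := fun u =>
    dotr (x i u - X q) (x i u - X q)) (ex_intro _ u0 Zu0) cZ.
  apply: continuous_in_subspaceT => u /set_mem[Bu _].
  exact: (cpar (fun p => dotr (X p - X q) (X p - X q)) u (cdist _ _ cX) (Bcod u Bu)).
have {}Ku1 : K (param i u1) = m := Ku1.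
have u0min : dotr (X (param i u1) - X q) (X (param i u1) - X q) <=
    dotr (X p0 - X q) (X p0 - X q).
  by have := u1min u0 (mem_set Zu0); rewrite /= pu0.
have u1_int : `|u0 - u1| < r / 2.
  rewrite lt_def Bu1 andbT; apply/eqP => ru1.
  have := dP u1 (esym ru1).
  exact: far_from_boundary d0 dq u0min.
have iu1 : cod i u1 := Bcod u1 Bu1.
have [p1 p1E] : exists p1, param i u1 = p1 by eexists.
rewrite p1E in Ku1 u0min.
pose y := 2^-1 *: (X p1 + X q).
pose T p := dotr (X p - y) (X p - y) - dotr (X p - y) (N p) ^+ 2.
pose L p := C + n%:R * K p * dotr (X p - y) (N p) -
  (dotr (X p - y) (X p) + K p * dotr (X p - y) (N p)).
have T1 : 0 < T p1.
  have TE : T p1 = dotr (X p1 - y - dotr (X p1 - y) (N p1) *: N p1)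
      (X p1 - y - dotr (X p1 - y) (N p1) *: N p1).
    rewrite /T; exact: tangential_part (normal_dotr1 N_normal p1).
  rewrite TE; apply: dotr_gt0; rewrite subr_eq0; apply/eqP => Xy.
  have uqu1 : uq = u1.
    apply: (rinj uq u1 (- (2 * dotr (X p1 - y) (N p1))) (Bball _ Buq) (Bball _ Bu1)).
    rewrite /= puq p1E scaleNr -scalerA -Xy /y.
    by apply/rowP => k; rewrite !mxE; field.
  by apply: Kq; rewrite -puq uqu1 p1E.
have n0 : (0 : R) < n%:R by rewrite ltr0n.
have [a a0 aP] : exists2 a : R, 0 < a & 0 < a * (K p1 ^+ 2 / n%:R) * T p1 - L p1.
  have c0 : 0 < K p1 ^+ 2 / n%:R * T p1.
    by rewrite Ku1; exact: (mulr_gt0 (divr_gt0 (exprn_gt0 2 m0) n0) T1).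
  exists ((`|L p1| + 1) / (K p1 ^+ 2 / n%:R * T p1)).
    exact: (divr_gt0 (ltr_wpDl (normr_ge0 _) ltr01) c0).
  rewrite -mulrA (divfK (lt0r_neq0 c0)) subr_gt0; apply: le_lt_trans (ler_norm _) _.
  by rewrite ltrDl.
pose Q p := a * (K p ^+ 2 / n%:R) * T p - L p.
have cXy : continuous (fun p => X p - y).
  by move=> p; apply: cvgB; [exact: cX|exact: cvg_cst].
have cXN := continuous_dotr cXy cN.
have cXX := continuous_dotr cXy cX.
have cXyy := continuous_dotr cXy cXy.
have cQ : continuous Q.
  move=> p; apply: cvgB.
    apply: cvgM; first by apply: cvgMr; apply: cvgMl; apply: cvgM; exact: cK.
    by apply: cvgB; [exact: cXyy|apply: cvgM; exact: cXN].
  apply: cvgB; last by apply: cvgD; [exact: cXX|apply: cvgM; [exact: cK|exact: cXN]].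
  apply: cvgD; first exact: cvg_cst.
  by apply: cvgM; [apply: cvgMr; exact: cK|exact: cXN].
have near1 : \forall u \near u1, `|u0 - u| < r / 2.
  exact: (cvgr_lt _ (cnorm u1) _ u1_int).
have near2 : \forall u \near u1, 0 < Q (param i u).
  have c := cpar Q u1 cQ iu1.
  by apply: (cvgr_gt _ c); rewrite /= p1E.
have near3 : \forall u \near u1, 0 < K (param i u).
  have c := cpar K u1 cK iu1.
  by apply: (cvgr_gt _ c); rewrite /= p1E Ku1.
have [V [oV Vu1] VP] := nbhs_open (filterI near1 (filterI near2 near3)).
pose h u := dotr (X (param i u) - y) (X (param i u) - y) / 2.
have chM : continuous (fun p => dotr (X p - y) (X p - y) / 2).
  by move=> p; apply: cvgMl; exact: cXyy.
have [|||||eps [u2 [eps0 Bu2 Vu2 u2max]]] :=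
    @perturbed_maximum R _ B V (K \o param i) h u1 a cB oV Bu1 Vu1 a0.
- by move=> u Bu; exact: (cpar K u cK (Bcod u Bu)).
- by move=> u Bu; exact: (cpar _ u chM (Bcod u Bu)).
- by move=> u Bu /=; rewrite p1E Ku1.
- by move=> u; exact: (divr_ge0 (dotr_ge0 _) (ler0n _ 2)).
- move=> u Bu /= Ku hu; rewrite p1E Ku1 in Ku.
  have umin := u1min u (mem_set (conj Bu Ku)).
  have {}umin : dotr (X p1 - X q) (X p1 - X q) <=
      dotr (X (param i u) - X q) (X (param i u) - X q) by rewrite -p1E; exact: umin.
  rewrite /h p1E in hu; have Xu := midpoint_closest umin (half _ _ hu).
  apply: (rinj _ _ 0 (Bball u Bu) (Bball u1 Bu1)).
  by rewrite scale0r /= p1E Xu subrr.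
have [_ [Q2 K2]] := VP u2 Vu2.
have iu2 := Bcod u2 Bu2.
have [p2 p2E] : exists p2, param i u2 = p2 by eexists.
have ip2 : dom i p2 by rewrite -p2E; exact: param_dom.
have c2 : Defs.coord i p2 = u2 by rewrite -p2E paramK.
rewrite p2E in Q2 K2.
have p2max : \forall q' \near p2,
    K q' + eps * expR (- a * (dotr (X q' - y) (X q' - y) / 2)) <=
    K p2 + eps * expR (- a * (dotr (X p2 - y) (X p2 - y) / 2)).
  have near_dom : \forall q' \near p2, dom i q'.
    exact: (open_nbhs_nbhs (conj (@dom_open _ _ _ S i) ip2)).
  have near_V : \forall q' \near p2, V (Defs.coord i q').
    have cc : Defs.coord i @ p2 --> u2 by rewrite -c2; exact: Defs.coord_continuous.
    exact: (cc _ (open_nbhs_nbhs (conj oV Vu2))).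
  apply: filterS (filterI near_dom near_V) => q' [iq' Vq'].
  have [Bq' _] := VP _ Vq'.
  have := u2max (Defs.coord i q') (ltW Bq').
  by rewrite /h /= (coordK iq') p2E.
have bar := exponential_barrier n_gt0 X_isometric N_normal X_weakly_convex X_shrinker
  sigma_le HK_le a0 eps0 K2 p2max.
by move: Q2; rewrite /Q subr_gt0 => /(fun h => le_lt_trans bar h); rewrite ltxx.
Qed.

End StrongMaximumPrinciple.

(** * Constant curvature, and the theorem *)

Section UnitSphere.
Context {R : realType} {n : nat} {M : topologicalType}.
Context {S : smooth_atlas R n M} {g : riemannian_metric S}.
Context {X N : M -> 'rV[R]_n.+1}.
Hypothesis n_gt0 : (0 < n)%N.
Hypothesis M_connected : connected [set: M].
Hypothesis M_nonempty : [set: M] !=set0.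
Hypothesis X_isometric : isometric_immersion g X.
Hypothesis N_normal : unit_normal_field S X N.
Hypothesis X_proper : proper_map X.
Hypothesis X_weakly_convex : weakly_convex g X N.
Hypothesis X_shrinker : gauss_self_shrinker S X N.

Local Notation x i := (X \o param i).
Local Notation nu i := (N \o param i).
Local Notation curv p := (tnth (principal_curvatures S X N p)).
Local Notation K := (gauss_kronecker S X N).
Local Notation H := (mean_curvature S X N).

Lemma maximum_set_full (C : R) p :
  (forall q, sigma S X N n.-1 q <= C) -> (forall q, H q * K q <= n%:R) ->
  0 < K p -> (forall q, K q <= K p) -> forall q, K q = K p.
Proof.
move=> sC HK Kp Kmax.
have cK := gauss_kronecker_continuous N_normal X_proper X_shrinker.
have [m Em] : exists m, K p = m by eexists.
rewrite Em in Kp Kmax *.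
pose A : set M := K @^-1` [set m].
have AT : A = [set: M].
  apply: M_connected; first by exists p.
  - exists A; last by rewrite setTI.
    rewrite openE => q Aq; have {}Aq : K q = m := Aq.
    have := @maximum_set_open _ _ _ _ _ _ _ n_gt0 X_isometric N_normal X_proper
      X_weakly_convex X_shrinker C sC HK q.
    by rewrite Aq; apply.
  - exists A; last by rewrite setTI.
    by apply: preimage_closed (@closed_eq _ m) => z _; exact: cK.
move=> q; have Aq : A q by rewrite AT.
exact: Aq.
Qed.

Section ConstantCurvature.
Variable m : R.
Hypothesis m_gt0 : 0 < m.
Hypothesis K_const : forall q, K q = m.

Lemma position_normal q : X q = - (m *: N q).
Proof.
rewrite -(K_const q); apply: (max_position X_isometric N_normal X_shrinker).
  by move=> z; rewrite !K_const.
by rewrite K_const.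
Qed.

(** On a sphere of radius [m] all curvatures are [1 / m], so [m = (1 / m)^n]. *)
Lemma radius_eq1 : m = 1.
Proof.
have [p _] := M_nonempty.
have [e [ee ed]] := principal_frame X_isometric N_normal p.
move: ee ed; set i := chart_at S p; set u := Defs.coord i p => ee ed.
have iu : cod i u by apply/coord_cod/chart_atP.
have m0 : m != 0 := lt0r_neq0 m_gt0.
have nuE : nu i = (fun t => - m^-1 *: x i t).
  apply/funext => t; rewrite /= position_normal.
  by rewrite scalerN scaleNr opprK scalerA mulVf// scale1r.
have ce j : curv p j = m^-1.
  have [_ dnu] := is_deriveZ (- m^-1) (is_derive_position X_isometric (e j) iu).
  have E : 'D_(e j) (nu i) u = - m^-1 *: 'D_(e j) (x i) u by rewrite nuE.
  have := ed j; rewrite E scaleNr => /eqP; rewrite eqr_opp => /eqP E2.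
  have := congr1 (fun z => dotr z ('D_(e j) (x i) u)) E2.
  by rewrite !dotrZl ee eqxx !mulr1.
have mE : m = m^-1 ^+ n.
  apply: etrans (esym (K_const p)) _.
  rewrite /gauss_kronecker (eq_bigr (fun=> m^-1)) => [|j _]; last exact: ce.
  by rewrite prodr_const card_ord.
have : m ^+ n.+1 = 1.
  by rewrite exprS {1}mE exprVn mulVf// expf_neq0.
by move/eqP; rewrite pexpr_eq1// ?ltW// => /eqP.
Qed.

(** The image lies in the unit sphere. A nearest point of the image to a point
    [y] of the sphere is [y] or its antipode; in the latter case the whole image
    is one point, which an immersion excludes. *)
Lemma constant_curvature_sphere : is_unit_sphere X.
Proof.
have XN q : X q = - N q by rewrite position_normal radius_eq1 scale1r.
have XX q : dotr (X q) (X q) = 1.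
  by rewrite XN dotrNl dotrNr opprK (normal_dotr1 N_normal).
apply/seteqP; split=> [_ [p _ <-] /=|y /= yy]; first exact: XX.
have [p pmin] := minimum_exists N_normal X_proper M_nonempty y 0 (lexx 0).
pose i := chart_at S p; pose u := Defs.coord i p.
have ip : dom i p by exact: chart_atP.
have iu : cod i u by exact: coord_cod.
have pu : param i u = p by exact: coordK.
have [e [d [ee _]]] := exists_diagonal_frame X_isometric N_normal iu.
have pmin' : forall q', dotr (x i u - y) (x i u - y) / 2 +
    0 * (dotr (nu i u - 0) (nu i u - 0) / 2) <=
    dotr (X q' - y) (X q' - y) / 2 + 0 * (dotr (N q' - 0) (N q' - 0) / 2).
  by move=> q'; rewrite /= pu; exact: pmin.
(* the nearest point of the hypersurface to [y] lies on the line through [y] *)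
have yE : y = dotr y (X p) *: X p.
  have := frame_expansion N_normal iu ee (X p - y).
  rewrite big1 => [|j _]; last first.
    have := minimum_critical X_isometric N_normal (e j) iu pmin'.
    by rewrite mul0r addr0 /= pu => ->; rewrite scale0r.
  rewrite add0r /= pu => E.
  have NX : N p = - X p by rewrite XN opprK.
  move: E; rewrite NX dotrNr scaleNr scalerN opprK dotrBl XX scalerBl scale1r.
  by move=> /addrI/oppr_inj.
pose c := dotr y (X p).
have c2 : c ^+ 2 = 1.
  by move: yy; rewrite yE dotrZl dotrZr XX mulr1 -expr2.
have := c2 => /eqP; rewrite sqrf_eq1 => /orP[/eqP c1|/eqP cN1].
  by exists p => //; rewrite yE -/c c1 scale1r.
(* otherwise [y] is the antipode of its nearest point, and [X] is constant *)
have yX : dotr y (X p) = -1 := cN1.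
have Xq q : X q = - y.
  have := pmin q; rewrite !mul0r !addr0.
  rewrite !(dotrDl, dotrDr, dotrNl, dotrNr) !XX yy (dotrC (X p) y) yX (dotrC (X q) y).
  move=> h; apply/eqP; rewrite -subr_eq0 opprK; apply/eqP/dotr_eq0/le_anti.
  rewrite dotr_ge0 andbT !(dotrDl, dotrDr) XX yy (dotrC (X q) y).
  by move: (dotr y (X q)) h => t; lra.
have x0 : 'D_(delta_mx 0 (Ordinal n_gt0)) (x i) u = 0.
  rewrite (_ : x i = cst (- y)) ?derive_cst//.
  by apply/funext => t; exact: Xq.
have /rowP/(_ (Ordinal n_gt0)) := immersion_injective X_isometric iu x0.
by rewrite !mxE !eqxx => /eqP; rewrite oner_eq0.
Qed.

End ConstantCurvature.

End UnitSphere.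

Theorem corollary1p2 (R : realType) (n : nat) (n_gt0 : (0 < n)%N)
  (M : topologicalType)
  (M_hausdorff : hausdorff_space M)
  (M_second_countable : @second_countable M)
  (M_connected : connected [set: M])
  (M_nonempty : [set: M] !=set0)
  (S : smooth_atlas R n M) (g : riemannian_metric S)
  (X N : M -> 'rV[R]_n.+1)
  (X_isometric : isometric_immersion g X)
  (N_normal : unit_normal_field S X N)
  (M_complete : riemannian_complete g)
  (X_proper : proper_map X)
  (X_weakly_convex : weakly_convex g X N)
  (X_shrinker : gauss_self_shrinker S X N)
  (sigma_bounded : exists C : R, forall p, `|sigma S X N n.-1 p| <= C)
  (HK_le : forall p,
     mean_curvature S X N p * gauss_kronecker S X N p <= n%:R) :
  (is_unit_sphere X \/ is_hyperplane X) /\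
  ((forall p, mean_curvature S X N p * gauss_kronecker S X N p < n%:R) ->
   is_hyperplane X).
Proof.
have [C sC'] := sigma_bounded.
have sC p : sigma S X N n.-1 p <= C by exact: le_trans (ler_norm _) (sC' p).
have [p pmax] := gauss_kronecker_attains_max X_isometric N_normal X_proper
  X_weakly_convex X_shrinker n_gt0 M_nonempty sC HK_le.
have K0 := gauss_kronecker_ge0 X_isometric N_normal X_weakly_convex.
have [Kp|Kp] := ltP 0 (gauss_kronecker S X N p).
  have HKp := max_HK X_isometric N_normal X_weakly_convex X_shrinker HK_le pmax Kp.
  split; last by move=> /(_ p); rewrite HKp ltxx.
  left; apply: (constant_curvature_sphere n_gt0 M_nonempty X_isometric N_normal
    X_proper X_shrinker Kp).
  exact: (maximum_set_full n_gt0 M_connected X_isometric N_normal X_proper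
    X_weakly_convex X_shrinker sC HK_le Kp pmax).
have hyp : is_hyperplane X.
  apply: (zero_curvature_hyperplane X_isometric N_normal X_proper M_connected
    M_nonempty _ X_shrinker) => q.
  by apply/le_anti; rewrite K0 (le_trans (pmax q) Kp).
by split; [right|].
Qed.
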